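(* Consider the infinite-horizon version of Problem P2. For a fixed finite-horizon policy $\Gamma^2$ for O2 (one with $\tau^2\le T^2$ for some finite $T^2$), an optimal policy for O1 is of the form $$Z^1_t=\begin{cases} b & \text{if } \pi^1_t<\alpha_t\\ 1 & \text{if } \alpha_t\le\pi^1_t\le\beta_t\\ b & \text{if } \beta_t<\pi^1_t<\delta_t\\ 0 & \text{if } \delta_t\le\pi^1_t\le\theta_t\\ b & \text{if } \pi^1_t>\theta_t\end{cases}$$ where $0\le\alpha_t\le\beta_t\le\delta_t\le\theta_t\le1$.
   Context: **Model.** $H\in\{0,1\}$ is random with known prior $P(H=0)=p_0$, $P(H=1)=1-p_0$. There are two observers O1, O2. $Y^i_t\in\mathcal{Y}^i$ is the observation of O$i$ at time $t=1,2,\dots$; given $H$, it has either a discrete distribution $P^i_t(\cdot|H)$ or a density $f^i_t(\cdot|H)$. Given $H$, the observations of each observer at different times are independent, and the two observation sequences are independent. $X_{1:t}$ denotes $X_1,\dots,X_t$; $b$ is a blank message (no transmission). **O1.** As long as it has not sent a final message, at time $t$ O1 chooses $Z^1_t=\gamma^1_t(Y^1_{1:t})\in\{0,1,b\}$; $\tau^1=\min\{t: Z^1_t\in\{0,1\}\}$. It sends only this single final message and gets no feedback from O2. O1's belief is $\pi^1_t=P(H=0|Y^1_{1:t})$. **Infinite-horizon Problem P2.** O2 takes measurements from time $t=1$; at each time $t$, after O1's action at time $t$, O2 (if not stopped) chooses $U^2_t=\gamma^2_t(Y^2_{1:t},Z^1_{1:t})\in\{0,1,N\}$ ($N$ = continue),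 where for $t>\tau^1$ the sequence $Z^1_{1:t}$ means $Z^1_{1:\tau^1}$; $\tau^2=\min\{t:U^2_t\in\{0,1\}\}$. O2 may stop before O1 does. $\tau^1,\tau^2$ need not be bounded. The objective is to minimize $\mathbb{E}^{\Gamma^1,\Gamma^2}\{c^1\tau^1+c^2\tau^2+J(U^2_{\tau^2},H)\}$ over $\Gamma^1=(\gamma^1_1,\gamma^1_2,\dots)$, $\Gamma^2=(\gamma^2_1,\gamma^2_2,\dots)$, where $c^1,c^2$ are finite positive numbers and $0\le J\le L<\infty$, $J(0,1)>J(1,1)$, $J(1,0)>J(0,0)$. Attention is restricted to policies for which $\mathbb{E}\tau^1$ and $\mathbb{E}\tau^2$ are finite (otherwise the cost is infinite). For fixed $\Gamma^2$, an optimal policy for O1 is a $\Gamma^1$ minimizing this cost.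
   Formalization: The claim fails if O2 reads labels backwards (T^2=1, U^2=1-Z^1_1), so it is proved that at each t the form holds with 0 and 1 possibly exchanged, and literally if final messages at t naming the true H cost, summed over H, no more than those naming the false H. *)

(* Defs.v *)
From HB Require Import structures.
From mathcomp Require Import all_boot all_order all_algebra.
From mathcomp Require Import all_classical all_reals all_analysis.
Import Order.TTheory GRing.Theory Num.Theory.
Import numFieldNormedType.Exports.

Set Implicit Arguments.
Unset Strict Implicit.
Unset Printing Implicit Defensive.

Local Open Scope classical_set_scope.
Local Open Scope ring_scope.

(* The hypotheses H = 0, H = 1 are [false], [true].  Both the messages
   {0, 1, b} of O1 and the actions {0, 1, N} of O2 are values of
   [option bool]: [None] is b for O1 and N for O2.
   Times are 1, 2, 3, ...; the entry of index 0 of a sequence indexed by time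
   is never used. *)
Definition action := option bool.

(* y_{1:t} *)
Definition hist (T : Type) (y : nat -> T) (t : nat) : t.-tuple T :=
  [tuple y i.+1 | i < t].

Definition policy1 (T : Type) := forall t : nat, t.-tuple T -> action.

(* The second argument is the list of the messages received so far. *)
Definition policy2 (T : Type) :=
  forall t : nat, t.-tuple T -> seq action -> action.

(* min {t >= 1 | a_t is 0 or 1}, with [None] for the minimum of the empty
   set. *)
Definition stop_time (a : nat -> action) : option nat :=
  match pselect (exists t, (0 < t)%N && (a t != None)) with
  | left ex => Some (ex_minn ex)
  | right _ => None
  end.

(* a_tau for tau = stop_time a *)
Definition final_action (a : nat -> action) : action := obind a (stop_time a).

Definition time_ereal (R : realType) (tau : option nat) : \bar R :=
  if tau is Some t then (t%:R)%:E else +oo%E.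

Definition messages1 (T1 : Type) (G1 : policy1 T1) (y1 : nat -> T1) :
  nat -> action := fun t => G1 t (hist y1 t).

(* z_{1:t}, which means z_{1:tau} for t > tau = stop_time z *)
Definition received (z : nat -> action) (t : nat) : seq action :=
  [seq z s | s <- iota 1 (if stop_time z is Some tau then minn tau t else t)].

Definition actions2 (T2 : Type) (G2 : policy2 T2) (y2 : nat -> T2)
  (z : nat -> action) : nat -> action :=
  fun t => G2 t (hist y2 t) (received z t).

Definition measurable_policy1 d (T1 : measurableType d) (G1 : policy1 T1) :=
  forall t (u : action), measurable [set y | G1 t y = u].

Definition measurable_policy2 d (T2 : measurableType d) (G2 : policy2 T2) :=
  forall t (m : seq action) (u : action), measurable [set y | G2 t y m = u].

Definition finite_horizon (T2 : Type) (G2 : policy2 T2) (n : nat) :=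
  forall (y2 : nat -> T2) (z : nat -> action),
    exists2 t, stop_time (actions2 G2 y2 z) = Some t & (t <= n)%N.

Section Model.
Context (R : realType) (d d1 d2 : measure_display).
Context (Om : measurableType d) (T1 : measurableType d1)
  (T2 : measurableType d2).
Context (P : probability Om R) (H : {mfun Om >-> bool})
  (Y1 : nat -> {mfun Om >-> T1}) (Y2 : nat -> {mfun Om >-> T2}).

(* A conditional probability density at each time, for each hypothesis, with
   respect to a reference measure: the counting measure of a countable set for
   an observation with a discrete distribution, Lebesgue measure for one with
   an ordinary density. *)
Definition densities d' (T : measurableType d')
    (nu : nat -> {sigma_finite_measure set T -> \bar R})
    (f : nat -> bool -> T -> R) :=
  forall t h, [/\ measurable_fun setT (f t h), forall y, 0 <= f t h y
    & (\int[nu t]_y (f t h y)%:E = 1)%E].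

(* Last field: given H = h, the observations Y^i_t (i = 1, 2, t >= 1) are
   independent and Y^i_t has the density f^i_t( . | h). *)
Record observation_model (p0 : R)
    (nu1 : nat -> {sigma_finite_measure set T1 -> \bar R})
    (nu2 : nat -> {sigma_finite_measure set T2 -> \bar R})
    (f1 : nat -> bool -> T1 -> R) (f2 : nat -> bool -> T2 -> R) : Prop := {
  model_prior : P [set w | H w = false] = p0%:E ;
  model_density1 : densities nu1 f1 ;
  model_density2 : densities nu2 f2 ;
  model_cond_law : forall (h : bool) (n : nat)
      (A : nat -> set T1) (B : nat -> set T2),
    (forall t, measurable (A t)) -> (forall t, measurable (B t)) ->
    (P [set w | H w = h /\
        forall t, (1 <= t <= n)%N -> A t (Y1 t w) /\ B t (Y2 t w)] =
     P [set w | H w = h] *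
     ((\prod_(1 <= t < n.+1) \int[nu1 t]_(y in A t) (f1 t h y)%:E) *
      (\prod_(1 <= t < n.+1) \int[nu2 t]_(y in B t) (f2 t h y)%:E)))%E
}.

(* [pi t], composed with Y^1_{1:t}, is a version of the conditional
   probability P(H = 0 | Y^1_{1:t}). *)
Definition is_belief1 (pi : forall t : nat, t.-tuple T1 -> R) :=
  forall t, (0 < t)%N ->
  let X w := hist (fun s => Y1 s w) t in
  [/\ measurable_fun setT (pi t),
      P.-integrable setT (fun w => (pi t (X w))%:E)
    & forall B : set (t.-tuple T1), measurable B ->
      (\int[P]_(w in X @^-1` B) (pi t (X w))%:E =
       P ([set w | H w = false] `&` X @^-1` B))%E].

Definition tau1 (G1 : policy1 T1) (w : Om) : \bar R :=
  time_ereal R (stop_time (messages1 G1 (Y1 ^~ w))).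

Definition admissible1 (G1 : policy1 T1) :=
  measurable_policy1 G1 /\ (\int[P]_w tau1 G1 w < +oo)%E.

Section Cost.
Context (c1 c2 : R) (J : bool -> bool -> R) (G2 : policy2 T2).

(* c^2 tau^2 + J(U^2_{tau^2}, H) when O1 sends the sequence z; if tau^2 is
   infinite the value is +oo whatever the second term. *)
Definition cost2 (z : nat -> action) (w : Om) : \bar R :=
  let a := actions2 G2 (Y2 ^~ w) z in
  (c2%:E * time_ereal R (stop_time a) +
   (if final_action a is Some u then J u (H w) else 0)%:E)%E.

Definition cost (G1 : policy1 T1) : \bar R :=
  (\int[P]_w (c1%:E * tau1 G1 w + cost2 (messages1 G1 (Y1 ^~ w)) w))%E.

Definition optimal1 (G1 : policy1 T1) :=
  admissible1 G1 /\ forall G, admissible1 G -> (cost G1 <= cost G)%E.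

(* E[c^2 tau^2 + J(U^2_{tau^2}, H) | H = h] when the final message of O1 is u,
   sent at time t *)
Definition cond_cost2 (t : nat) (u h : bool) : \bar R :=
  (((fine (P [set w | H w = h]))^-1)%:E *
   \int[P]_(w in [set w | H w = h])
     cost2 (fun s => if s == t then Some u else None) w)%E.

(* O2 does not take the two final messages at time t in the reverse sense:
   summed over the two hypotheses, a final message naming the true hypothesis
   costs no more than one naming the false hypothesis.  An arbitrary policy of
   O2 may fail this at some times t (reading 0 as 1 and 1 as 0, say), and then
   0 and 1 exchange places in the optimal rule of O1 at time t. *)
Definition labels_aligned (t : nat) : Prop :=
  (cond_cost2 t false false + cond_cost2 t true true <=
   cond_cost2 t true false + cond_cost2 t false true)%E.

End Cost.
End Model.

(* [g] sends [u] on [al, be], [v] on [de, th], and b elsewhere.  The cases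
   overlap only if be = de, at that point, where either message is allowed. *)
Definition threshold_rule (R : realType) (u v : bool) (al be de th : R)
    (g : R -> action) :=
  forall x : R,
    x < al /\ g x = None \/
    al <= x <= be /\ g x = Some u \/
    be < x < de /\ g x = None \/
    de <= x <= th /\ g x = Some v \/
    th < x /\ g x = None.

(* Main.v *)
Require Import Defs.
From HB Require Import structures.
From mathcomp Require Import all_boot all_order all_algebra.
From mathcomp Require Import all_classical all_reals all_analysis.
From mathcomp Require Import measurable_realfun ring lra.
Import Order.TTheory GRing.Theory Num.Theory.
Import numFieldNormedType.Exports.
Local Open Scope classical_set_scope.
Local Open Scope ring_scope.

Set Implicit Arguments.
Unset Strict Implicit.
Unset Printing Implicit Defensive.

(** Once the policy of O2 is fixed and stops by time n, O1 faces an optimal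
    stopping problem.  Given the hypothesis, the observations of O1 and O2 are
    independent, so the expected cost of sending u at time t is a linear
    function S_u of the pair (p, 1 - p), where p is the belief of O1.  At time
    n + 1 O2 has stopped, messages have lost their effect, and waiting only
    costs time; so only n + 1 stages matter.  Backward induction defines the
    least cost from time t on as a function V_t of the weights (a, b) of the two
    hypotheses:
      V_t (a, b) = min (S_0 (a, b), S_1 (a, b), W_t (a, b)),
      W_t (a, b) = the integral over y of V_(t+1) (a f(y | 0), b f(y | 1)),
    f being the density of the observation at time t + 1.

    The weights are not normalised, which makes V_t positively homogeneous and
    superadditive ([superlinear]); minima and integrals keep these properties.
    On the segment a + b = 1 they make W_t concave and Lipschitz.  Hence the
    beliefs at which u is a best choice, those where S_u is at most W_t and at
    most the cost of the other message, form a closed interval, and since the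
    difference of S_0 and S_1 is monotone along the segment, the two intervals
    follow each other ([threshold_optimal]).  A threshold rule sends a message
    at one belief at least; if waiting is better everywhere, that belief is
    chosen among those that O1 almost surely does not hold at time t
    ([exists_non_atom]).

    The link with expectations is [integral_bayes_step]: over an event known at
    time t, V_(t+1) at the next belief and W_t at the current one have the same
    integral.  It rests on [integral_homogeneous]: the integral of a homogeneous
    function of the densities of two measures does not depend on the measure
    with respect to which the densities are taken.  By backward induction the
    expectation of V_1 at the first belief bounds the cost of every policy from
    below, and it is attained by the policies that almost surely do what the
    minimum in V_t prescribes ([prescribed_optimal]). *)

(** * Integrals and densities *)

Section Integration.
Context d (T : measurableType d) (R : realType).
Local Open Scope ereal_scope.

(** The integral of a nonnegative function is a supremum over the simple
    functions below it; so this form of monotonicity applies to the cost of a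
    policy, whose measurability is not established. *)
Lemma ge0_integral_mono (mu : {measure set T -> \bar R}) (f g : T -> \bar R) :
  (forall x, 0 <= f x) -> (forall x, f x <= g x) ->
  \int[mu]_x f x <= \int[mu]_x g x.
Proof.
move=> f0 fg; have g0 x : 0 <= g x by exact: le_trans (fg x).
rewrite !ge0_integralTE//; apply: le_ereal_sup => _ [h /= hf <-].
by exists h => // x; exact: le_trans (fg x).
Qed.

(** The function that is infinite on [N] and zero elsewhere has integral zero,
    and its sum with [g] dominates [f] everywhere. *)
Lemma ge0_integral_ae_mono (mu : {measure set T -> \bar R}) (N : set T)
    (f g : T -> \bar R) :
  (forall x, 0 <= f x) -> (forall x, 0 <= g x) -> measurable_fun [set: T] g ->
  measurable N -> mu N = 0 -> (forall x, ~ N x -> f x <= g x) ->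
  \int[mu]_x f x <= \int[mu]_x g x.
Proof.
move=> f0 g0 mg mN N0 fg; pose oo := (cst +oo : T -> \bar R) \_ N.
have oo0 x : 0 <= oo x by apply: erestrict_ge0 => y _; exact: leey.
apply: (@le_trans _ _ (\int[mu]_x (g x + oo x))).
  apply: ge0_integral_mono => // x; rewrite /oo patchE.
  have [xN|xN] := boolP (x \in N).
    by rewrite addey ?leey// gt_eqF// (lt_le_trans _ (g0 x)).
  by rewrite adde0 fg//; rewrite notin_setE in xN.
rewrite ge0_integralD//; last first.
  by apply/(measurable_restrictT _ mN).1; exact: measurable_cst.
by rewrite -(integral_mkcond N) integral_cst// N0 mule0 adde0.
Qed.

(** The change of variables is that of the Radon-Nikodym derivative, which is
    [f] almost everywhere. *)
Lemma density_measure (mu : {sigma_finite_measure set T -> \bar R})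
    (f : T -> R) :
  measurable_fun setT f -> (forall x, (0 <= f x)%R) ->
  \int[mu]_x (f x)%:E < +oo ->
  exists m : {finite_measure set T -> \bar R},
    (forall A, measurable A -> m A = \int[mu]_(x in A) (f x)%:E) /\
    (forall (g : T -> \bar R) A, (forall x, 0 <= g x) -> measurable A ->
      measurable_fun A g ->
      \int[m]_(x in A) g x = \int[mu]_(x in A) (g x * (f x)%:E)).
Proof.
move=> mf f0 foo.
pose dm (A : set T) := \int[mu]_(x in A) (f x)%:E.
have dm0 : dm set0 = 0 by rewrite /dm integral_set0.
have dm_ge0 A : 0 <= dm A by apply: integral_ge0 => x _; rewrite lee_fin.
have mfE A : measurable_fun A (EFin \o f).
  by apply: measurable_funTS; exact/measurable_EFinP.
have dm_add : semi_sigma_additive dm.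
  move=> F mF tF mUF; rewrite [X in _ --> X]ge0_integral_bigcup//; first last.
  - by move=> x _; rewrite lee_fin.
  by apply: (@is_cvg_nneseries _ (fun k => dm (F k)))=> k _ _; exact: dm_ge0.
pose m0 : {measure set T -> \bar R} :=
  HB.pack dm (isMeasure.Build _ _ _ dm dm0 dm_ge0 dm_add).
have m0fin : fin_num_fun m0.
  by apply: lty_fin_num_fun; rewrite /= /m0/= /dm.
pose m : {finite_measure set T -> \bar R} :=
  HB.pack dm (isMeasure.Build _ _ _ dm dm0 dm_ge0 dm_add)
    (Measure_isFinite.Build _ _ _ m0 m0fin).
have mE A : m A = \int[mu]_(x in A) (f x)%:E by [].
have ab : m `<< mu.
  apply/null_content_dominatesP => A mA A0.
  by rewrite mE null_set_integral//; exact: mfE.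
exists m; split => // g A g0 mA mg.
rewrite -(Radon_Nikodym_SigmaFinite.change_of_variables ab)//.
have mRN := measurable_int _ (Radon_Nikodym_SigmaFinite.f_integrable ab).
apply: ae_eq_integral => //.
- by apply: emeasurable_funM => //; exact: measurable_funTS.
- by apply: emeasurable_funM => //; exact: mfE.
apply: ae_eqe_mul2l.
apply: ae_eq_subset (@subsetT _ A) _; apply: ae_eq_sym.
apply: integral_ae_eq => //.
- apply/integrableP; split; first exact: mfE.
  by under eq_integral do rewrite gee0_abs ?lee_fin//.
- by move=> E _ mE'; rewrite -Radon_Nikodym_SigmaFinite.f_integral.
Qed.

(** The measures of density [p] and [1 - p] with respect to [m'] are those of
    density [g0] and [g1] with respect to [m].  Hence [m'] has the density
    [s = g0 + g1], whence [g0 = p * s] and [g1 = (1 - p) * s] almost everywhere,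
    and homogeneity takes the factor [s] out of [v]. *)
Lemma integral_homogeneous (m : {sigma_finite_measure set T -> \bar R})
    (m' : {finite_measure set T -> \bar R}) (p g0 g1 : T -> R)
    (v : R -> R -> R) :
  measurable_fun setT p -> measurable_fun setT g0 -> measurable_fun setT g1 ->
  (forall x, 0 <= p x <= 1)%R ->
  (forall x, 0 <= g0 x)%R -> (forall x, 0 <= g1 x)%R ->
  (forall A, measurable A ->
    \int[m']_(x in A) (p x)%:E = \int[m]_(x in A) (g0 x)%:E) ->
  (forall A, measurable A ->
    \int[m']_(x in A) (1 - p x)%:E = \int[m]_(x in A) (g1 x)%:E) ->
  (forall c a b, 0 <= c -> v (c * a) (c * b) = c * v a b)%R ->
  (forall a b, 0 <= a -> 0 <= b -> 0 <= v a b)%R ->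
  measurable_fun setT (fun x => v (p x) (1 - p x)%R) ->
  measurable_fun setT (fun x => v (g0 x) (g1 x)) ->
  forall A, measurable A ->
    \int[m']_(x in A) (v (p x) (1 - p x))%:E =
    \int[m]_(x in A) (v (g0 x) (g1 x))%:E.
Proof.
move=> mp mg0 mg1 p01 g00 g10 e0 e1 hv v0 mv1 mv2.
have p0 x : (0 <= p x)%R by case/andP: (p01 x).
have p1 x : (0 <= 1 - p x)%R by case/andP: (p01 x); rewrite subr_ge0.
pose s x := (g0 x + g1 x)%R.
have s0 x : (0 <= s x)%R by exact: addr_ge0.
have ms : measurable_fun setT s by exact: measurable_funD.
have mE (h : T -> R) A : measurable_fun setT h -> measurable_fun A (EFin \o h).
  by move=> mh; apply: measurable_funTS; exact/measurable_EFinP.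
have sE A : measurable A -> \int[m]_(x in A) (s x)%:E = m' A.
  move=> mA; under eq_integral do rewrite EFinD.
  rewrite ge0_integralD//; try exact: mE; try by move=> x _; rewrite lee_fin.
  rewrite -e0// -e1// -ge0_integralD//; last 4 first.
  - by move=> x _; rewrite lee_fin.
  - exact: mE.
  - by move=> x _; rewrite lee_fin.
  - by apply: mE; exact: measurable_funB.
  under eq_integral do rewrite -EFinD addrC subrK.
  by rewrite integral_cst// mul1e.
have [|n [nE cov]] := @density_measure m s ms s0.
  by rewrite sE// ltey_eq fin_num_measure.
have {}cov (g : T -> R) A : measurable A -> measurable_fun setT g ->
    (forall x, 0 <= g x)%R ->
    \int[m']_(x in A) (g x)%:E = \int[m]_(x in A) (g x * s x)%:E.
  move=> mA mg gge0; rewrite (@eq_measure_integral _ _ _ _ n).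
    by rewrite cov//; exact: mE.
  by move=> B mB _; exact: etrans (esym (sE B mB)) (esym (nE B mB)).
have psg0 : ae_eq m setT (fun x => (g0 x)%:E) (fun x => (p x * s x)%:E).
  apply: integral_ae_eq => //.
  - apply/integrableP; split; first exact: mE.
    under eq_integral do rewrite gee0_abs ?lee_fin//.
    rewrite -e0//; apply: (@le_lt_trans _ _ (\int[m']_x (cst 1 x))).
      apply: ge0_integral_mono => x; rewrite /= lee_fin//.
      by case/andP: (p01 x).
    by rewrite integral_cst// mul1e ltey_eq fin_num_measure.
  - by apply: mE; exact: measurable_funM.
  - by move=> E _ mE'; rewrite -e0// cov.
move=> A mA; rewrite cov//; last by move=> x; exact: v0.
apply: ae_eq_integral => //.
- by apply: mE; exact: measurable_funM.
- exact: mE.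
apply: filterS psg0 => x /(_ I) [g0E] _.
congr EFin; rewrite mulrC -hv// mulrC -g0E.
by rewrite mulrBr mulr1 [(s x * _)%R]mulrC -g0E /s addrC addKr.
Qed.
End Integration.

(** * Measures on finite sequences *)

Lemma measurable_box d (T : measurableType d) n (A : nat -> set T) :
  (forall i, measurable (A i)) ->
  measurable [set x : n.-tuple T | forall i : 'I_n, A i (tnth x i)].
Proof.
move=> mA; rewrite [X in measurable X](_ : _ =
    \big[setI/setT]_(i < n) ((@tnth _ T ^~ i) @^-1` (A i))).
  apply: bigsetI_measurable => i _; rewrite -[X in measurable X]setTI.
  exact: measurable_tnth.
rewrite -bigcap_seq; apply/seteqP; split => x /= h i //=.
by apply: h; rewrite /= mem_index_enum.
Qed.

(** Boxes form a pi-system that generates the sigma-algebra of tuples. *)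
Lemma tuple_measure_unique d (T : measurableType d) (R : realType) n
    (m1 m2 : {measure set (n.-tuple T) -> \bar R}) :
  (m1 setT < +oo)%E ->
  (forall A : nat -> set T, (forall i, measurable (A i)) ->
    m1 [set x | forall i : 'I_n, A i (tnth x i)] =
    m2 [set x | forall i : 'I_n, A i (tnth x i)]) ->
  forall B, measurable B -> m1 B = m2 B.
Proof.
move=> fin1 m12.
pose box (A : nat -> set T) :=
  [set x : n.-tuple T | forall i : 'I_n, A i (tnth x i)].
pose G :=
  [set box A | A in [set A : nat -> set T | forall i, measurable (A i)]].
have GE : @measurable _ (n.-tuple T) = <<s G >>.
  apply/seteqP; split.
    apply: smallest_sub; first exact: smallest_sigma_algebra.
    move=> X; rewrite -bigcup_seq => -[i _ [C mC <-]].
    rewrite setTI; apply: sub_sigma_algebra.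
    exists (fun j => if j == val i then C else setT).
      by move=> j; case: ifP.
    apply/seteqP; split=> x /=; first by move=> /(_ i); rewrite eqxx.
    move=> h j; case: ifP => // /eqP ji.
    by have -> : j = i by exact: val_inj.
  apply: smallest_sub; first exact: sigma_algebra_measurable.
  by move=> _ [A mA <-]; exact: measurable_box.
move=> B; apply: (measure_unique G (fun=> setT)) => //.
- move=> _ _ [A mA <-] [C mC <-]; exists (fun i => A i `&` C i).
    by move=> i; exact: measurableI.
  apply/seteqP; split=> x /=.
    by move=> h; split=> i; case: (h i).
  by move=> [h1 h2] i; split.
- by move=> _; exists (fun=> setT) => //; apply/seteqP; split.
- exact: bigcup_const.
- by move=> _ [A mA <-]; exact: m12.
Qed.

(** * Concave functions of two weights *)

(** Homogeneity and superadditivity amount to concavity on the segment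
    [a + b = 1], and unlike concavity in the belief they pass through Bayes'
    rule at once, the weights being multiplied by likelihoods.  The functions
    are defined on the whole plane: there the lower bound makes them
    Lipschitz. *)
Record superlinear (R : realType) (v : R -> R -> R) : Prop := {
  superlinearZ : forall c a b : R, 0 <= c -> v (c * a) (c * b) = c * v a b ;
  superlinearD : forall a b a' b' : R, v a b + v a' b' <= v (a + a') (b + b') ;
  superlinear_bound :
    exists K : R, forall a b : R, - (K * (`|a| + `|b|)) <= v a b
}.

Section Superlinear.
Context (R : realType).
Implicit Types v w : R -> R -> R.

(** By superadditivity, increments of [v] are at least its values at the
    increments of the arguments. *)
Lemma superlinear_lipschitz v : superlinear v ->
  exists2 K, 0 <= K & forall a b a' b',
    v a b <= v a' b' + K * (`|a - a'| + `|b - b'|).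
Proof.
move=> [_ vD [K Kv]]; exists `|K| => // a b a' b'.
have := vD a b (a' - a) (b' - b); rewrite !subrKC.
have := Kv (a' - a) (b' - b); rewrite [`|a' - a|]distrC [`|b' - b|]distrC.
have : K * (`|a - a'| + `|b - b'|) <= `|K| * (`|a - a'| + `|b - b'|).
  by apply: ler_wpM2r (ler_norm K); exact: addr_ge0.
lra.
Qed.

Lemma superlinear00 v : superlinear v -> v 0 0 = 0.
Proof. by move=> /superlinearZ/(_ 0 0 0 (lexx _)); rewrite !mul0r. Qed.

Lemma superlinear_norm v : superlinear v ->
  exists K, forall a b, `|v a b| <= K * (`|a| + `|b|).
Proof.
move=> sv; have [K K0 lip] := superlinear_lipschitz sv; exists K => a b.
rewrite ler_norml; apply/andP; split.
  by have := lip 0 0 a b; rewrite superlinear00// !sub0r !normrN; lra.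
by have := lip a b 0 0; rewrite superlinear00// !subr0; lra.
Qed.

Lemma superlinear_linear (A B : R) : superlinear (fun a b => a * A + b * B).
Proof.
split; first by move=> *; ring.
  by move=> *; rewrite le_eqVlt; apply/orP; left; apply/eqP; ring.
exists (`|A| + `|B|) => a b.
have := ler_norm (- (a * A)); have := ler_norm (- (b * B)).
rewrite !normrN !normrM mulrDl !mulrDr.
have := mulr_ge0 (normr_ge0 A) (normr_ge0 b).
have := mulr_ge0 (normr_ge0 B) (normr_ge0 a).
rewrite [`|a| * _]mulrC [`|b| * _]mulrC; lra.
Qed.

Lemma superlinear_min v w : superlinear v -> superlinear w ->
  superlinear (fun a b => Num.min (v a b) (w a b)).
Proof.
move=> [vZ vD [K Kv]] [wZ wD [L Lw]]; split.
- by move=> c a b c0; rewrite vZ// wZ// minr_pMr.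
- move=> a b a' b'; rewrite le_min; apply/andP; split.
    by apply: le_trans (vD _ _ _ _); apply: lerD; rewrite ge_min lexx.
  by apply: le_trans (wD _ _ _ _); apply: lerD; rewrite ge_min lexx orbT.
exists (`|K| + `|L|) => a b.
have n0 : 0 <= `|a| + `|b| by exact: addr_ge0.
have KK := ler_wpM2r n0 (ler_norm K); have LL := ler_wpM2r n0 (ler_norm L).
have := mulr_ge0 (normr_ge0 K) n0; have := mulr_ge0 (normr_ge0 L) n0.
rewrite le_min; have := Kv a b; have := Lw a b; rewrite [(_ + `|L|) * _]mulrDl.
by move=> *; apply/andP; split; lra.
Qed.

Lemma superlinearB v (A B : R) : superlinear v ->
  superlinear (fun a b => v a b - (a * A + b * B)).
Proof.
move=> sv; have [K Kv] := superlinear_norm sv.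
have [L Ll] := superlinear_norm (superlinear_linear A B).
case: sv => vZ vD _; split.
- by move=> c a b c0; rewrite vZ//; ring.
- by move=> a b a' b'; have := vD a b a' b'; lra.
exists (K + L) => a b; have := Kv a b; have := Ll a b.
by rewrite !ler_norml => /andP[_ h1] /andP[h2 _]; lra.
Qed.

(** By the Lipschitz property, [v] is the supremum of the downward cones with
    apex on its graph above a rational point, so that a strict superlevel set is
    a countable union. *)
Lemma superlinear_measurable d (T : measurableType d) v (f g : T -> R) :
  superlinear v -> measurable_fun setT f -> measurable_fun setT g ->
  measurable_fun setT (fun x => v (f x) (g x)).
Proof.
move=> sv mf mg; have [K K0 lip] := superlinear_lipschitz sv.
apply: (measurability _ (RGenOInfty.measurableE R)) => _ [_ [r ->] <-].
rewrite setTI.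
pose h (p q : rat) x := v (ratr p) (ratr q) -
  K * (`|f x - ratr p| + `|g x - ratr q|).
have mh p q : measurable_fun setT (h p q).
  apply: measurable_funB => //; apply: measurable_funM => //.
  by apply: measurable_funD; apply: measurableT_comp => //;
    apply: measurable_funB.
rewrite [X in measurable X](_ : _ =
    \bigcup_p \bigcup_q (h p q @^-1` `]r, +oo[%classic)); last first.
  apply/seteqP; split=> x /=; rewrite in_itv/= andbT; last first.
    move=> [p _ [q _]] /=; rewrite in_itv/= andbT => /lt_le_trans; apply.
    have := lip (ratr p) (ratr q) (f x) (g x).
    by rewrite /h [`|_ - f x|]distrC [`|_ - g x|]distrC; lra.
  (* with both rational coordinates within e of the point, v loses at most
     2 K e and so does the cone *)
  move=> rv; pose e := (v (f x) (g x) - r) / (8 * (K + 1)).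
  have K1 : 0 < K + 1 by lra.
  have e0 : 0 < e by rewrite divr_gt0 ?mulr_gt0// subr_gt0.
  have [p] := @rat_in_itvoo R (f x) (f x + e) ltac:(lra).
  have [q] := @rat_in_itvoo R (g x) (g x + e) ltac:(lra).
  rewrite !in_itv/= => /andP[q1 q2] /andP[p1 p2].
  exists p => //; exists q => //=; rewrite in_itv/= andbT /h.
  have := lip (f x) (g x) (ratr p) (ratr q).
  have fp : f x - ratr p <= 0 by lra.
  have gq : g x - ratr q <= 0 by lra.
  rewrite (ler0_norm fp) (ler0_norm gq) !opprB.
  have : K * (ratr p - f x + (ratr q - g x)) <= (K + 1) * (2 * e).
    by apply: ler_pM => //; lra.
  have -> : (K + 1) * (2 * e) = (v (f x) (g x) - r) / 4 by rewrite /e; field; lra.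
  lra.
by apply: bigcupT_measurable_rat => p; apply: bigcupT_measurable_rat => q;
  rewrite -[X in measurable X]setTI; exact: mh.
Qed.

Section Integral.
Context d (T : measurableType d) (nu : {measure set T -> \bar R}).
Context (f0 f1 : T -> R).
Hypothesis mf0 : measurable_fun setT f0.
Hypothesis mf1 : measurable_fun setT f1.
Hypothesis f0_ge0 : forall y, 0 <= f0 y.
Hypothesis f1_ge0 : forall y, 0 <= f1 y.
Hypothesis int_f0 : (\int[nu]_y (f0 y)%:E = 1)%E.
Hypothesis int_f1 : (\int[nu]_y (f1 y)%:E = 1)%E.

Let if0 : nu.-integrable setT (EFin \o f0).
Proof.
apply/integrableP; split; first exact/measurable_EFinP.
by under eq_integral do rewrite /= ger0_norm//; rewrite int_f0 ltry.
Qed.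

Let if1 : nu.-integrable setT (EFin \o f1).
Proof.
apply/integrableP; split; first exact/measurable_EFinP.
by under eq_integral do rewrite /= ger0_norm//; rewrite int_f1 ltry.
Qed.

Let ilin (A B : R) : nu.-integrable setT (fun y => (A * f0 y + B * f1 y)%:E).
Proof.
have := integrableD measurableT (integrableZl measurableT A if0)
  (integrableZl measurableT B if1).
by apply: eq_integrable => // y _ /=.
Qed.

Let int_lin (A B : R) : Rintegral nu setT (fun y => A * f0 y + B * f1 y) = A + B.
Proof.
rewrite /Rintegral; under eq_integral do rewrite EFinD !EFinM.
rewrite integralD//; [|exact: integrableZl if0|exact: integrableZl if1].
by rewrite !integralZl// int_f0 int_f1 !mule1.
Qed.

Lemma superlinear_integrable v a b : superlinear v ->
  nu.-integrable setT (fun y => (v (a * f0 y) (b * f1 y))%:E).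
Proof.
move=> sv; have [K Kv] := superlinear_norm sv.
apply: (le_integrable measurableT _ _ (ilin (K * `|a|) (K * `|b|))).
  by apply/measurable_EFinP/superlinear_measurable => //; exact: measurable_funM.
move=> y _; rewrite lee_fin; apply: le_trans (Kv _ _) _.
rewrite !normrM [`|f0 y|]ger0_norm// [`|f1 y|]ger0_norm//.
apply: le_trans (ler_norm _).
by rewrite le_eqVlt; apply/orP; left; apply/eqP; ring.
Qed.

Lemma superlinear_integral v : superlinear v ->
  superlinear (fun a b => Rintegral nu setT (fun y => v (a * f0 y) (b * f1 y))).
Proof.
move=> sv; have isv a b := superlinear_integrable a b sv.
have [K Kv] := superlinear_norm sv; case: (sv) => vZ vD _; split.
- move=> c a b c0; rewrite -(RintegralZl _ measurableT (isv a b)); 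
  by apply: eq_Rintegral => y _; rewrite -!mulrA vZ.
- move=> a b a' b'; rewrite -(RintegralD measurableT (isv a b) (isv a' b')).
  apply: (le_Rintegral measurableT _ (isv _ _)).
    exact: (integrableD measurableT (isv a b) (isv a' b')).
  by move=> y _; apply: le_trans (vD _ _ _ _) _; rewrite !mulrDl.
exists K => a b.
have -> : - (K * (`|a| + `|b|)) = (- K * `|a|) + (- K * `|b|) by ring.
rewrite -int_lin; apply: (le_Rintegral measurableT (ilin _ _) (isv _ _)) => y _.
have := Kv (a * f0 y) (b * f1 y); rewrite ler_norml => /andP[+ _].
rewrite !normrM [`|f0 y|]ger0_norm// [`|f1 y|]ger0_norm//; lra.
Qed.

End Integral.

(** Concavity makes the superlevel set an interval; it contains its infimum and
    its supremum by continuity. *)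
Lemma superlinear_superlevel (F : R -> R -> R) : superlinear F ->
  (forall x, 0 <= x <= 1 -> F x (1 - x) < 0) \/
  exists a b, [/\ 0 <= a, a <= b, b <= 1 &
    forall x, 0 <= x <= 1 -> (0 <= F x (1 - x)) = (a <= x <= b)].
Proof.
move=> sF; pose A := [set x : R | 0 <= x <= 1 /\ 0 <= F x (1 - x)].
have [[z Az]|A0] := pselect (A !=set0); last first.
  left=> x x01; rewrite ltNge; apply/negP => Fx; apply: A0; by exists x.
right; have [K K0 lip] := superlinear_lipschitz sF.
have Aub : has_ubound A by exists 1 => x [/andP[]].
have Alb : has_lbound A by exists 0 => x [/andP[]].
have supA : has_sup A by split; [exists z|].
have infA : has_inf A by split; [exists z|].
have close (y : R) : (forall e, 0 < e -> exists2 x, A x & `|x - y| <= e) ->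
    0 <= F y (1 - y).
  move=> h; apply/ler_addgt0Pr => e e0.
  have K1 : 0 < 2 * (K + 1) by lra.
  have [x [_ Fx] xy] := h (e / (2 * (K + 1))) (divr_gt0 e0 K1).
  have := lip x (1 - x) y (1 - y).
  have -> : 1 - x - (1 - y) = y - x by ring.
  rewrite [`|y - x|]distrC => FF.
  have : K * (`|x - y| + `|x - y|) <= (K + 1) * (2 * (e / (2 * (K + 1)))).
    by apply: ler_pM; [by []|by rewrite addr_ge0|lra|lra].
  have -> : (K + 1) * (2 * (e / (2 * (K + 1)))) = e by field; lra.
  lra.
have i0 : 0 <= inf A by apply: lb_le_inf => [|x [/andP[]]//]; exists z.
have s1 : sup A <= 1 by apply: ge_sup => [|x [/andP[]]//]; exists z.
have iz : inf A <= z by exact: ge_inf.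
have zs : z <= sup A by exact: ub_le_sup.
have Fi : 0 <= F (inf A) (1 - inf A).
  apply: close => e e0; have [x Ax xe] := inf_adherent e0 infA.
  exists x => //; rewrite ger0_norm ?subr_ge0; last exact: ge_inf.
  by rewrite lerBlDl ltW.
have Fs : 0 <= F (sup A) (1 - sup A).
  apply: close => e e0; have [x Ax xe] := sup_adherent e0 supA.
  exists x => //; rewrite distrC ger0_norm ?subr_ge0; last exact: ub_le_sup.
  by rewrite lerBlDl -lerBlDr ltW.
exists (inf A), (sup A); split=> //; first exact: le_trans zs.
move=> x x01; apply/idP/idP => [Fx|/andP[ix xs]].
  by apply/andP; split; [apply: ge_inf|apply: ub_le_sup].
have [ltis|] := ltP (inf A) (sup A); last first.
  by move=> si; have -> : x = inf A by lra.
pose c := (x - inf A) / (sup A - inf A).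
have c0 : 0 <= c by apply: divr_ge0; lra.
have c1 : 0 <= 1 - c.
  by rewrite subr_ge0 ler_pdivrMr ?mul1r; lra.
have cE : c * (sup A - inf A) = x - inf A by rewrite divfK//; lra.
have := superlinearD sF (c * sup A) (c * (1 - sup A))
  ((1 - c) * inf A) ((1 - c) * (1 - inf A)).
rewrite !superlinearZ//.
have -> : c * sup A + (1 - c) * inf A = x by lra.
have -> : c * (1 - sup A) + (1 - c) * (1 - inf A) = 1 - x by lra.
by apply: le_trans; apply: addr_ge0; apply: mulr_ge0.
Qed.
End Superlinear.

(** * Threshold rules *)

Section Threshold.
Context (R : realType).

(** [pu] tells which message has the priority at a belief common to the two
    intervals, so that either of them may be reduced to an endpoint of the other
    without being used. *)
Lemma threshold_ruleP (pu u v : bool) (al be de th : R) :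
  al <= be -> be <= de -> de <= th ->
  threshold_rule u v al be de th (fun x =>
    if (al <= x <= be) && (pu || ~~ (de <= x <= th)) then Some u
    else if de <= x <= th then Some v else None).
Proof.
move=> ab bd dt x; have [xal|alx] := ltP x al.
  left; split=> //=; rewrite ifF//.
  by apply/negbTE/negP => /andP[? _]; lra.
have [xbe|bex] := leP x be; rewrite /= ?andbF/=.
  case: ifPn => [_|]; first by right; left.
  by rewrite negb_or negbK => /andP[_ dxt]; rewrite dxt; do 3 right; left.
have [xde|dex] := ltP x de; first by right; right; left.
by right; right; right; have [xth|thx] := leP x th; [left|right].
Qed.

Lemma measurable_threshold (pu u v : bool) (al be de th : R) a :
  measurable [set x : R | (if (al <= x <= be) && (pu || ~~ (de <= x <= th))
    then Some u else if de <= x <= th then Some v else None) = a].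
Proof.
pose I (b c : R) := [set x : R | b <= x <= c].
have mI b c : measurable (I b c).
  rewrite (_ : I b c = `[b, c]%classic); first exact: measurable_itv.
  by apply/seteqP; split=> x /=; rewrite in_itv.
pose D1 := I al be `&` ((if pu then setT else set0) `|` ~` I de th).
have mD1 : measurable D1.
  apply: measurableI => //; apply: measurableU; last exact: measurableC.
  by case: (pu).
pose D2 := I de th `\` D1.
have mD2 : measurable D2 by exact: measurableD.
pose D3 := ~` (D1 `|` D2).
have mD3 : measurable D3 by apply: measurableC; exact: measurableU.
rewrite (_ : [set _ | _] = ((if a == Some u then D1 else set0) `|`
  (if a == Some v then D2 else set0)) `|` (if a == None then D3 else set0)).
  by repeat apply: measurableU; case: ifP.
have HD1 x : D1 x <-> (al <= x <= be) && (pu || ~~ (de <= x <= th)).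
  rewrite /D1 /I/=; split.
    by move=> [-> /= [|/negP ->]]; rewrite ?orbT//; case: (pu).
  move=> /andP[-> h]; split => //; case/orP: h => [->|/negP]; [by left|by right].
apply/seteqP; split=> x /=.
  case: ifPn => [/HD1 h <-|/negP h]; first by left; left; rewrite eqxx.
  have nD1 : ~ D1 x by move/HD1.
  case: ifPn => [h2 <-|h2 <-]; first by left; right; rewrite eqxx; split.
  by right => -[//|[h3 _]]; move/negP: h2; apply.
move=> [[|]|].
- by case: ifP => // /eqP -> /HD1 ->.
- case: ifP => // /eqP -> [h2 h1]; rewrite ifF; first by rewrite ifT.
  by apply/negP => /HD1.
- case: ifP => // /eqP -> h; rewrite ifF; last first.
    by apply/negP => /HD1 ?; apply: h; left.
  rewrite ifF//; apply/negP => h2; apply: h.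
  by have [?|?] := pselect (D1 x); [left|right; split].
Qed.

(** [A c] and [B c] are the costs of the message [c] under the two hypotheses,
    [W] is the cost of waiting.  The message [c] is a best choice at [x] when
    [F c x (1 - x)] is nonnegative, which describes a closed interval.  By the
    condition on the slopes, the beliefs in favour of [~~ s] lie on the left of
    those in favour of [s].
    If neither message is ever a best choice, both intervals are reduced to the
    exceptional point [x0]. *)
Lemma threshold_optimal (A B : bool -> R) (W : R -> R -> R) (s : bool)
    (x0 : R) :
  let ell c x := x * A c + (1 - x) * B c in
  superlinear W -> A s - B s <= A (~~ s) - B (~~ s) -> 0 <= x0 <= 1 ->
  exists al be de th g,
    [/\ (0 <= al) && (al <= be) && (be <= de) && (de <= th) && (th <= 1),
        threshold_rule (~~ s) s al be de th g,
        forall a, measurable [set x | g x = a] &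
        forall x, 0 <= x <= 1 -> x != x0 ->
          if g x is Some c
          then ell c x <= W x (1 - x) /\ forall c', ell c x <= ell c' x
          else forall c, W x (1 - x) <= ell c x].
Proof.
move=> ell sW slope /andP[x00 x01].
pose F c a b := Num.min (a * A (~~ c) + b * B (~~ c) - (a * A c + b * B c))
  (W a b - (a * A c + b * B c)).
have sF c : superlinear (F c).
  apply: superlinear_min; last exact: superlinearB.
  exact/superlinearB/superlinear_linear.
have F_ge0 c x : 0 <= F c x (1 - x) ->
    ell c x <= W x (1 - x) /\ forall c', ell c x <= ell c' x.
  rewrite le_min => /andP[h1 h2]; split; first by rewrite /ell; lra.
  by move: h1; case: c {h2} => h1 [|]; rewrite /ell/= in h1 *; lra.
have F_lt0 x : F true x (1 - x) < 0 -> F false x (1 - x) < 0 ->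
    forall c, W x (1 - x) <= ell c x.
  rewrite /F !gt_min /= => /orP h1 /orP h2 c.
  by case: c; rewrite /ell; case: h1; case: h2 => h1 h2; lra.
have build (pu : bool) (al be de th : R) :
    0 <= al -> al <= be -> be <= de -> de <= th -> th <= 1 ->
    let g x := if (al <= x <= be) && (pu || ~~ (de <= x <= th))
      then Some (~~ s) else if de <= x <= th then Some s else None in
    (forall x, 0 <= x <= 1 -> x != x0 ->
      if g x is Some c then (0 <= F c x (1 - x) : Prop)
      else F true x (1 - x) < 0 /\ F false x (1 - x) < 0) ->
    exists al be de th g,
    [/\ (0 <= al) && (al <= be) && (be <= de) && (de <= th) && (th <= 1),
        threshold_rule (~~ s) s al be de th g,
        forall a, measurable [set x | g x = a] &
        forall x, 0 <= x <= 1 -> x != x0 ->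
          if g x is Some c
          then ell c x <= W x (1 - x) /\ forall c', ell c x <= ell c' x
          else forall c, W x (1 - x) <= ell c x].
  move=> h1 h2 h3 h4 h5 g gF; exists al, be, de, th, g; split.
  - by rewrite h1 h2 h3 h4 h5.
  - exact: (threshold_ruleP pu (~~ s) s h2 h3 h4).
  - by move=> a; exact: measurable_threshold.
  - move=> x x01' xx0; have := gF x x01' xx0; case: (g x) => [c|[]].
      exact: F_ge0.
    exact: F_lt0.
have Fs x : F s x (1 - x) < 0 -> F (~~ s) x (1 - x) < 0 ->
    F true x (1 - x) < 0 /\ F false x (1 - x) < 0.
  by case: (s) => /= ? ?; split.
have [Hu|[a [b [a0 ab b1 Hu]]]] := superlinear_superlevel (sF (~~ s));
  have [Hv|[a' [b' [a'0 a'b' b'1 Hv]]]] := superlinear_superlevel (sF s).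
- apply: (build true x0 x0 x0 x0) => // x x01' xx0.
  rewrite -!eq_le eq_sym (negbTE xx0)/=.
  by apply: Fs; [exact: Hv|exact: Hu].
- apply: (build false a' a' a' b') => // x x01' xx0.
  have HV := Hv x x01'.
  have [h|h] := boolP (a' <= x <= b'); first by rewrite andbF HV.
  rewrite andbT ifF; last first.
    apply/negbTE/negP => /andP[? ?]; move/negP: h; apply.
    by apply/andP; split; lra.
  by apply: Fs; [rewrite ltNge HV|exact: Hu].
- apply: (build true a b b b) => // x x01' xx0.
  have HU := Hu x x01'; rewrite andbT.
  have [h|h] := boolP (a <= x <= b); first by rewrite HU.
  rewrite ifF; last first.
    apply/negbTE/negP => /andP[? ?]; move/negP: h; apply.
    by apply/andP; split; lra.
  by apply: Fs; [exact: Hv|rewrite ltNge HU].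
have [ba'|a'b] := leP b a'.
  apply: (build true a b a' b') => // x x01' xx0.
  have HU := Hu x x01'; have HV := Hv x x01'; rewrite andbT.
  have [h|h] := boolP (a <= x <= b); first by rewrite HU.
  have [h2|h2] := boolP (a' <= x <= b'); first by rewrite HV.
  by apply: Fs; rewrite ltNge ?HU ?HV.
(* intervals that overlap in more than a point: the two messages cost the
   same at every belief, and one interval is enough *)
have b01 : 0 <= b <= 1 by apply/andP; split; lra.
have a'01 : 0 <= a' <= 1 by apply/andP; split; lra.
have := Hu b b01; rewrite ab lexx => /F_ge0[_ /(_ s)].
have := Hv a' a'01; rewrite a'b' lexx => /F_ge0[_ /(_ (~~ s))].
rewrite /ell => e1 e2.
have sl0 : A s - B s = A (~~ s) - B (~~ s).
  apply/eqP; rewrite eq_le slope/=; nra.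
have B0 : B s = B (~~ s) by nra.
have A0 : A s = A (~~ s) by lra.
have FF x : F s x (1 - x) = F (~~ s) x (1 - x).
  by rewrite /F negbK A0 B0.
apply: (build true a b b b) => // x x01' xx0.
have HU := Hu x x01'; rewrite andbT.
have [h|h] := boolP (a <= x <= b); first by rewrite HU.
rewrite ifF; last first.
  apply/negbTE/negP => /andP[? ?]; move/negP: h; apply.
    by apply/andP; split; lra.
by apply: Fs; rewrite ?FF ltNge HU.
Qed.

End Threshold.

(** * Stopping times of sequences of actions *)

Section StopTime.
Implicit Types (a z : nat -> action) (t s : nat).

Lemma stop_timeP a t : stop_time a = Some t <->
  [/\ (0 < t)%N, a t != None & forall r, (0 < r < t)%N -> a r = None].
Proof.
rewrite /stop_time; case: pselect => [ex|nex].
  case: ex_minnP => m /andP[m0 am] mmin; split.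
    move=> [<-]; split=> // r /andP[r0 rm]; apply/eqP/negPn/negP => ar.
    by have := mmin r; rewrite r0 ar leqNgt rm => /(_ isT).
  move=> [t0 at0 tmin]; congr Some; apply/eqP; rewrite eqn_leq.
  rewrite mmin ?t0 ?at0// leqNgt; apply/negP => mt.
  by rewrite tmin ?m0 ?mt in am.
split=> // -[t0 at0 _]; case: nex; exists t; exact/andP.
Qed.

Lemma stop_time_NoneP a :
  stop_time a = None <-> forall t, (0 < t)%N -> a t = None.
Proof.
rewrite /stop_time; case: pselect => [ex|nex]; split=> //.
  by move=> h; have [t /andP[t0]] := ex; rewrite h.
move=> _ t t0; apply/eqP/negPn/negP => at0; apply: nex; exists t; exact/andP.
Qed.

Definition message t (u : bool) : nat -> action :=
  fun s => if s == t then Some u else None.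

Definition silence : nat -> action := fun=> None.

Lemma received_blank z n t : (forall r, (0 < r <= n)%N -> z r = None) ->
  (t <= n)%N -> received z t = nseq t None.
Proof.
move=> zn tn; rewrite /received.
have -> : (if stop_time z is Some tau then minn tau t else t) = t.
  case E: (stop_time z) => [tau|//]; case/stop_timeP: E => tau0 ztau _.
  apply/minn_idPr; rewrite leqNgt; apply/negP => taut.
  by rewrite zn ?tau0 ?(leq_trans (ltnW taut)) in ztau.
apply: (@eq_from_nth _ None); rewrite ?size_map ?size_iota ?size_nseq// => i it.
rewrite (nth_map 0%N) ?size_iota// nth_nseq it nth_iota// zn//=.
by rewrite (leq_trans _ tn).
Qed.

Lemma stop_time_message t u : (0 < t)%N -> stop_time (message t u) = Some t.
Proof.
move=> t0; apply/stop_timeP; split=> //; rewrite /message ?eqxx//.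
by move=> r /andP[_ rt]; rewrite ltn_eqF.
Qed.

(** Before the final message O2 receives blanks, and afterwards nothing. *)
Lemma received_message z t u : stop_time z = Some t -> z t = Some u ->
  received z = received (message t u).
Proof.
move=> zt ztu; case/stop_timeP: (zt) => t0 _ zmin.
apply/funext => s; rewrite /received zt stop_time_message//.
apply/eq_in_map => r; rewrite mem_iota add1n ltnS leq_min => /and3P[r0 rt _].
rewrite /message; case: eqP => [->//|/eqP rt'].
by rewrite zmin// r0 ltn_neqAle rt' rt.
Qed.

(** A stopped cost by recursion on the time left: expectations of such costs
    are computed by backward induction, and their measurability is that of
    finitely many choices. *)
Fixpoint first_stop (V : Type) (val : nat -> bool -> V) (dflt : V) a k s : V :=
  if k is k'.+1 then
    if a s is Some u then val s u else first_stop val dflt a k' s.+1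
  else dflt.

Lemma first_stopE V (val : nat -> bool -> V) dflt a k s t u :
  stop_time a = Some t -> a t = Some u -> (0 < s <= t)%N -> (t < s + k)%N ->
  first_stop val dflt a k s = val t u.
Proof.
move=> /stop_timeP[_ _ tmin] atu; elim: k s => [|k IH] s /andP[s0 st] tsk.
  by rewrite addn0 ltnNge st in tsk.
rewrite /=; move: st; rewrite leq_eqVlt => /predU1P[->|st]; first by rewrite atu.
by rewrite tmin ?s0// IH// addSnnS.
Qed.

Lemma first_stop_default V (val : nat -> bool -> V) dflt a k s :
  (forall r, (s <= r < s + k)%N -> a r = None) ->
  first_stop val dflt a k s = dflt.
Proof.
elim: k s => //= k IH s an; rewrite an; last by rewrite leqnn addnS ltnS leq_addr.
by apply: IH => r /andP[sr rk]; rewrite an// (ltnW sr) -addSnnS.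
Qed.

Lemma eq_first_stop V (val : nat -> bool -> V) dflt a a' k s :
  (forall r, (s <= r < s + k)%N -> a r = a' r) ->
  first_stop val dflt a k s = first_stop val dflt a' k s.
Proof.
elim: k s => //= k IH s an; rewrite an; last by rewrite leqnn addnS ltnS leq_addr.
case: (a' s) => // ; apply: IH => r /andP[sr rk].
by rewrite an// (ltnW sr) -addSnnS.
Qed.

Lemma first_stop_ind V (Q : V -> Prop) (val : nat -> bool -> V) dflt a k s :
  Q dflt -> (forall r u, (s <= r < s + k)%N -> Q (val r u)) ->
  Q (first_stop val dflt a k s).
Proof.
move=> Qd; elim: k s => //= k IH s Qv.
case: (a s) => [u|]; first by apply: Qv; rewrite leqnn addnS ltnS leq_addr.
by apply: IH => r u /andP[sr rk]; apply: Qv; rewrite (ltnW sr) -addSnnS.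
Qed.

Lemma measurable_first_stop d (T : measurableType d) (R : realType)
    (val : T -> nat -> bool -> \bar R) (dflt : T -> \bar R)
    (a : T -> nat -> action) k s :
  (forall r u, measurable [set x | a x r = u]) ->
  (forall r u, measurable_fun [set: T] (fun x => val x r u)) ->
  measurable_fun [set: T] dflt ->
  measurable_fun [set: T] (fun x => first_stop (val x) (dflt x) (a x) k s).
Proof.
move=> ma mv md; elim: k s => [|k IH] s //=.
rewrite (_ : (fun _ => _) = fun x => if a x s == Some true then val x s true
    else if a x s == Some false then val x s false
    else first_stop (val x) (dflt x) (a x) k s.+1); last first.
  by apply/funext => x; case: (a x s) => [[]|].
have mb u : measurable_fun setT (fun x => a x s == Some u).
  apply: (measurable_fun_bool true); rewrite setTI.
  rewrite (_ : _ @^-1` _ = [set x | a x s = Some u]); first exact: ma.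
  by apply/seteqP; split=> x /= /eqP.
by apply: measurable_fun_ifT => //; apply: measurable_fun_ifT.
Qed.

End StopTime.

(** * Uniqueness of laws and product densities *)

Section Laws.
Context d (Om : measurableType d) (R : realType) (P : probability Om R).
Local Open Scope ereal_scope.

(** The law of [X] on the event [D], scaled by [c].  A product formula for
    probabilities becomes the equality of two such laws. *)
Lemma restricted_law d' (S : measurableType d') (X : Om -> S) (c : R)
    (D : set Om) :
  measurable_fun setT X -> measurable D -> (0 <= c)%R ->
  exists m : {measure set S -> \bar R},
    (forall A, measurable A -> m A = c%:E * P (D `&` X @^-1` A)) /\
    (forall F : S -> \bar R, measurable_fun [set: S] F ->
      (forall x, 0 <= F x) ->
      \int[m]_x F x = c%:E * \int[P]_(w in D) F (X w)).
Proof.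
move=> mX mD c0; pose f w := (c * \1_D w)%R.
have mf : measurable_fun setT f.
  by apply: measurable_funM => //; exact: measurable_indic.
have f0 w : (0 <= f w)%R by rewrite mulr_ge0.
have fE A : measurable A -> \int[P]_(w in A) (f w)%:E = c%:E * P (D `&` A).
  move=> mA; under eq_integral do rewrite EFinM.
  rewrite ge0_integralZl//; first by rewrite integral_indic.
  by apply: measurable_funTS; exact/measurable_EFinP/measurable_indic.
have [|m0 [m0E m0I]] := @density_measure _ _ _ P f mf f0.
  by rewrite fE// ltey_eq fin_numM// fin_num_measure//; exact: measurableI.
exists (measure_function_pushforward__canonical__measure_function_Measure m0 mX); split.
  move=> A mA; rewrite /= /pushforward/= m0E ?fE//.
    by rewrite -[X in measurable X]setTI; exact: mX.
  by rewrite -[X in measurable X]setTI; exact: mX.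
move=> F mF F0; rewrite ge0_integral_pushforward//.
rewrite /= preimage_setT m0I//; last exact: measurableT_comp.
under eq_integral do rewrite EFinM muleCA.
rewrite ge0_integralZl//; last 2 first.
- apply: emeasurable_funM; first exact: measurableT_comp.
  by apply/measurable_EFinP; exact: measurable_indic.
- by move=> w _; rewrite mule_ge0.
congr (_ * _); rewrite [RHS]integral_mkcond; apply: eq_integral => w _.
by rewrite epatch_indic.
Qed.

Section TupleLaw.
Context d' (T : measurableType d') (n : nat) (X : Om -> n.-tuple T).
Context (c1 c2 : R) (D1 D2 : set Om).
Hypotheses (mX : measurable_fun setT X) (mD1 : measurable D1)
  (mD2 : measurable D2) (c1_ge0 : (0 <= c1)%R) (c2_ge0 : (0 <= c2)%R).
Hypothesis boxes : forall A : nat -> set T, (forall i, measurable (A i)) ->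
  c1%:E * P (D1 `&` X @^-1` [set x | forall i : 'I_n, A i (tnth x i)]) =
  c2%:E * P (D2 `&` X @^-1` [set x | forall i : 'I_n, A i (tnth x i)]).

Lemma tuple_law_unique B : measurable B ->
  c1%:E * P (D1 `&` X @^-1` B) = c2%:E * P (D2 `&` X @^-1` B).
Proof.
have [m1 [m1E _]] := restricted_law mX mD1 c1_ge0.
have [m2 [m2E _]] := restricted_law mX mD2 c2_ge0.
move=> mB; rewrite -m1E// -m2E//; apply: tuple_measure_unique => //.
  rewrite m1E// preimage_setT setIT ltey_eq fin_numM//.
  exact: fin_num_measure.
move=> A mA; have mbox := measurable_box (n := n) mA.
by rewrite m1E// m2E// boxes.
Qed.

Lemma tuple_law_unique_integral F : measurable_fun [set: n.-tuple T] F ->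
  (forall x, 0 <= F x) ->
  c1%:E * \int[P]_(w in D1) F (X w) = c2%:E * \int[P]_(w in D2) F (X w).
Proof.
have [m1 [m1E m1I]] := restricted_law mX mD1 c1_ge0.
have [m2 [m2E m2I]] := restricted_law mX mD2 c2_ge0.
move=> mF F0; rewrite -m1I// -m2I//; apply: eq_measure_integral => B mB _.
by rewrite m1E// m2E// tuple_law_unique.
Qed.
End TupleLaw.
End Laws.

Section ProductDensity.
Context d d' (T : measurableType d) (T' : measurableType d') (R : realType).
Context (m1 : {sigma_finite_measure set T -> \bar R})
  (m2 : {sigma_finite_measure set T' -> \bar R}).
Local Open Scope ereal_scope.

(** The product measure as a bundled sigma-finite measure, with respect to which
    densities can be considered. *)
Lemma product_sigma_finite :
  exists m : {sigma_finite_measure set (T * T')%type -> \bar R},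
    forall A, m A = (m1 \x m2) A.
Proof.
have sf : sigma_finite setT (m1 \x m2).
  have [F FT mF] := sigma_finiteT m1; have [G GT mG] := sigma_finiteT m2.
  pose FG k :=
    let ij := odflt (0, 0)%N (@unpickle (nat * nat)%type k) in
    F ij.1 `*` G ij.2.
  exists FG.
    apply/esym; rewrite -subTset => -[x y] _.
    have [i _ Fi] : (\bigcup_i F i) x by rewrite -FT.
    have [j _ Gj] : (\bigcup_i G i) y by rewrite -GT.
    by exists (pickle (i, j)) => //; rewrite /FG pickleK.
  move=> k; rewrite /FG; set ij := odflt _ _.
  have [mFi Fi] := mF ij.1; have [mGj Gj] := mG ij.2.
  split; first exact: measurableX.
  by rewrite product_measure1E// lte_mul_pinfty// ge0_fin_numE.
pose m : {sigma_finite_measure set (T * T')%type -> \bar R} :=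
  HB.pack (m1 \x m2) (Measure_isSigmaFinite.Build _ _ _ _ sf).
by exists m.
Qed.

Context (g : T -> R) (f : T' -> R).
Hypotheses (mg : measurable_fun setT g) (mf : measurable_fun setT f)
  (g0 : forall x, (0 <= g x)%R) (f0 : forall y, (0 <= f y)%R).

Lemma integral_rectangle B C : measurable B -> measurable C ->
  \int[m1 \x m2]_(z in B `*` C) (g z.1 * f z.2)%:E =
  (\int[m1]_(x in B) (g x)%:E) * \int[m2]_(y in C) (f y)%:E.
Proof.
move=> mB mC; rewrite integral_mkcond fubini_tonelli1; last 2 first.
- apply/(measurable_restrictT _ _).1; first exact: measurableX.
  apply: measurable_funTS; apply/measurable_EFinP; apply: measurable_funM;
    exact: measurableT_comp.
- by move=> z; apply: erestrict_ge0 => ? _; rewrite lee_fin mulr_ge0.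
rewrite -ge0_integralZr//; last 3 first.
- by apply: measurable_funTS; exact/measurable_EFinP.
- by move=> x _; rewrite lee_fin.
- by apply: integral_ge0 => y _; rewrite lee_fin.
rewrite [RHS]integral_mkcond; apply: eq_integral => x _; rewrite /fubini_F patchE.
have [xB|xB] := boolP (x \in B).
  rewrite -ge0_integralZl//; last 3 first.
  - by apply: measurable_funTS; exact/measurable_EFinP.
  - by move=> y _; rewrite lee_fin.
  - by rewrite lee_fin.
  rewrite [RHS]integral_mkcond; apply: eq_integral => y _; rewrite !patchE.
  by rewrite in_setX xB/=; case: ifP => //; rewrite EFinM.
by rewrite integral0_eq// => y _; rewrite patchE in_setX (negbTE xB).
Qed.

(** The two sides are finite measures that agree on rectangles. *)
Lemma product_density_unique (m : {measure set (T * T')%type -> \bar R}) :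
  \int[m1]_x (g x)%:E < +oo -> \int[m2]_y (f y)%:E < +oo ->
  (forall B C, measurable B -> measurable C ->
    m (B `*` C) = (\int[m1]_(x in B) (g x)%:E) * \int[m2]_(y in C) (f y)%:E) ->
  forall A, measurable A -> m A = \int[m1 \x m2]_(z in A) (g z.1 * f z.2)%:E.
Proof.
move=> goo foo mE A mA; have [m12 m12E] := product_sigma_finite.
have int12 D (F : (T * T')%type -> \bar R) :
    \int[m12]_(z in D) F z = \int[m1 \x m2]_(z in D) F z.
  by apply: eq_measure_integral => B _ _; exact: m12E.
pose k (z : (T * T')%type) := (g z.1 * f z.2)%R.
have mk : measurable_fun setT k by apply: measurable_funM; exact: measurableT_comp.
have [||n [nE _]] := @density_measure _ _ _ m12 k mk.
- by move=> z; exact: mulr_ge0.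
- rewrite int12 -setXTT integral_rectangle//.
  by rewrite lte_mul_pinfty ?ge0_fin_numE//; apply: integral_ge0 => *; rewrite lee_fin.
rewrite -int12 -nE//.
apply: (@measure_unique _ _ _ [set B `*` C | B in measurable & C in measurable]
  (fun=> setT)) => //.
- exact: measurable_prod_measurableType.
- move=> _ _ [B mB [C mC <-]] [B' mB' [C' mC' <-]].
  exists (B `&` B'); first exact: measurableI.
  by exists (C `&` C'); [exact: measurableI|rewrite setXI].
- by move=> _; exists setT => //; exists setT => //; rewrite setXTT.
- exact: bigcup_const.
- move=> _ [B mB [C mC <-]].
  rewrite mE//; apply/esym; apply: etrans (nE _ (measurableX mB mC)) _.
  by rewrite int12 integral_rectangle.
move=> _; rewrite -setXTT mE//.
by rewrite lte_mul_pinfty ?ge0_fin_numE//; apply: integral_ge0 => *; rewrite lee_fin.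
Qed.

End ProductDensity.

Lemma null_of_integral_le0 d (T : measurableType d) (R : realType)
    (m : {measure set T -> \bar R}) (D : set T) (f : T -> R) :
  measurable D -> measurable_fun D (EFin \o f) ->
  (forall x, D x -> 0 < f x) -> (\int[m]_(x in D) (f x)%:E <= 0)%E -> m D = 0%E.
Proof.
move=> mD mf f0 If.
have [+ _] := @ae_eq_integral_abs _ _ _ m D mD (EFin \o f) mf.
rewrite (eq_integral (EFin \o f)); last first.
  by move=> x /[!inE] Dx /=; rewrite gtr0_norm// f0.
move=> /(_ _)/wrap[].
  by apply/eqP; rewrite eq_le If/= integral_ge0// => x Dx; rewrite lee_fin ltW// f0.
move=> [N [mN N0 sub]]; apply/eqP; rewrite -measure_le0 -N0.
apply: le_measure; rewrite ?inE//.
move=> x Dx; apply: sub => /= /(_ Dx) [fx]; have := f0 _ Dx; by rewrite fx ltxx.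
Qed.

(** A law on the line has countably many atoms, and [[0, 1]] is uncountable. *)
Lemma exists_non_atom d (Om : measurableType d) (R : realType)
    (P : probability Om R) (X : Om -> R) : measurable_fun setT X ->
  exists2 x, 0 <= x <= 1 & P (X @^-1` [set x]) = 0%E.
Proof.
move=> mX; pose X' : {mfun Om >-> R} :=
  HB.pack X (isMeasurableFun.Build _ _ _ _ _ mX).
apply: contrapT => nex.
have sub : `[0, 1]%classic `<=` [set r | 0 < pmf (P := P) X' r].
  move=> x /=; rewrite in_itv/= => x01; rewrite lt_neqAle pmf_ge0 andbT.
  apply/eqP => p0; apply: nex; exists x => //.
  have mx : measurable (X @^-1` [set x]).
    rewrite -[Z in measurable Z]setTI.
    exact: (mX measurableT _ (measurable_set1 x)).
  by rewrite -[LHS]fineK ?fin_num_measure// -[fine _]p0.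
have := countable_lebesgue_measure0
  (sub_countable (subset_card_le sub) (pmf_gt0_countable X')).
rewrite lebesgue_measure_itv/= lte_fin ltr01 oppr0 adde0 => /eqP.
by rewrite onee_eq0.
Qed.
(** * Conditional independence of the observations *)

Section Model.
Context (R : realType) (d d1 d2 : measure_display)
  (Om : measurableType d) (T1 : measurableType d1) (T2 : measurableType d2)
  (P : probability Om R) (H : {mfun Om >-> bool})
  (Y1 : nat -> {mfun Om >-> T1}) (Y2 : nat -> {mfun Om >-> T2})
  (p0 : R)
  (nu1 : nat -> {sigma_finite_measure set T1 -> \bar R})
  (nu2 : nat -> {sigma_finite_measure set T2 -> \bar R})
  (f1 : nat -> bool -> T1 -> R) (f2 : nat -> bool -> T2 -> R).
Hypothesis model : observation_model P H Y1 Y2 p0 nu1 nu2 f1 f2.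
Local Open Scope ereal_scope.

Definition hypothesis (h : bool) : set Om := [set w | H w = h].
Definition past d' (T : measurableType d') (Y : nat -> {mfun Om >-> T}) t w :=
  hist (fun s => Y s w) t.

Lemma measurable_hypothesis h : measurable (hypothesis h).
Proof.
rewrite -[X in measurable X]setTI; exact: (measurable_funP H measurableT [set h]).
Qed.

Lemma measurable_past d' (T : measurableType d') (Y : nat -> {mfun Om >-> T}) t :
  measurable_fun setT (past Y t).
Proof.
apply/measurable_fun_tnthP => i.
rewrite (_ : _ \o _ = Y i.+1); first exact: measurable_funP.
by apply/funext => w /=; rewrite /past /hist tnth_mktuple.
Qed.

Lemma measurable_past_preimage d' (T : measurableType d')
    (Y : nat -> {mfun Om >-> T}) t (B : set (t.-tuple T)) :
  measurable B -> measurable (past Y t @^-1` B).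
Proof.
by move=> mB; rewrite -[X in measurable X]setTI; exact: measurable_past.
Qed.

Lemma density_integral_le1 d' (T : measurableType d')
    (nu : nat -> {sigma_finite_measure set T -> \bar R}) f t h A :
  densities nu f -> measurable A ->
  0 <= \int[nu t]_(y in A) (f t h y)%:E <= 1.
Proof.
move=> /(_ t h)[mf f0 fI] mA; apply/andP; split.
  by apply: integral_ge0 => y _; rewrite lee_fin.
rewrite -fI; apply: ge0_subset_integral => //; first exact/measurable_EFinP.
by move=> y _; rewrite lee_fin.
Qed.

(** The conditional probability that the observations at times 1 to [n] lie in
    the sets [A t]. *)
Let density_box d' (T : measurableType d')
    (nu : nat -> {sigma_finite_measure set T -> \bar R})
    (f : nat -> bool -> T -> R) h n (A : nat -> set T) :=
  \prod_(1 <= t < n.+1) \int[nu t]_(y in A t) (f t h y)%:E.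

(** Whole spaces contribute the factor 1, so that the two observers can be
    considered up to different times. *)
Let density_box_widen d' (T : measurableType d')
    (nu : nat -> {sigma_finite_measure set T -> \bar R}) f h n m
    (A : nat -> set T) :
  densities nu f -> (n <= m)%N ->
  density_box nu f h m (fun t => if (t <= n)%N then A t else setT) =
  density_box nu f h n A.
Proof.
move=> df nm; rewrite /density_box (@big_cat_nat _ _ _ n.+1)//=.
rewrite [X in _ * X = _]big_nat [X in _ * X = _]big1 ?mule1.
  by apply: eq_big_nat => t /andP[_]; rewrite ltnS => ->.
move=> t /andP[nt _]; rewrite leqNgt nt/=.
by have [] := df t h.
Qed.

Let density_box_fin d' (T : measurableType d')
    (nu : nat -> {sigma_finite_measure set T -> \bar R}) f h n (A : nat -> set T) :
  densities nu f -> (forall t, measurable (A t)) ->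
  exists2 r : R, (0 <= r)%R & density_box nu f h n A = r%:E.
Proof.
move=> df mA; rewrite /density_box; elim: n => [|n [r r0 IH]].
  by exists 1%R => //; rewrite big_geq.
rewrite big_nat_recr//= IH.
have /andP[i0 i1] := density_integral_le1 n.+1 h df (mA n.+1).
have ifin : \int[nu n.+1]_(y in A n.+1) (f n.+1 h y)%:E \is a fin_num.
  by rewrite ge0_fin_numE// (le_lt_trans i1)// ltry.
exists (r * fine (\int[nu n.+1]_(y in A n.+1) (f n.+1 h y)%:E))%R.
  by rewrite mulr_ge0// fine_ge0.
by rewrite EFinM fineK.
Qed.

Let density_box0 d' (T : measurableType d')
    (nu : nat -> {sigma_finite_measure set T -> \bar R}) f h A :
  density_box nu f h 0 A = 1.
Proof. by rewrite /density_box big_geq. Qed.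

Let box_law h t n (A : nat -> set T1) (B : nat -> set T2) :
  (forall s, measurable (A s)) -> (forall s, measurable (B s)) ->
  P (hypothesis h `&`
     past Y1 t @^-1` [set x | forall i : 'I_t, A i.+1 (tnth x i)] `&`
     past Y2 n @^-1` [set x | forall i : 'I_n, B i.+1 (tnth x i)]) =
  P (hypothesis h) * (density_box nu1 f1 h t A * density_box nu2 f2 h n B).
Proof.
move=> mA mB; case: model => _ df1 df2 law.
pose N := maxn t n.
rewrite -(density_box_widen h A df1 (leq_maxl t n)).
rewrite -(density_box_widen h B df2 (leq_maxr t n)) -/N.
rewrite -law; last 2 first.
- by move=> s; case: ifP.
- by move=> s; case: ifP.
congr (P _); apply/seteqP; split=> w /=.
  move=> [[hw Aw] Bw]; split=> // s /andP[s1 sN]; split; case: ifP => // st.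
    case: s s1 sN st => // s _ _ st.
    by have := Aw (Ordinal st); rewrite tnth_mktuple.
  case: s s1 sN st => // s _ _ st.
  by have := Bw (Ordinal st); rewrite tnth_mktuple.
move=> [hw ABw]; split; first split=> //.
  move=> i; rewrite tnth_mktuple; have [] := ABw i.+1.
    by rewrite /N leq_max ltn_ord.
  by rewrite ltn_ord.
move=> i; rewrite tnth_mktuple; have [] := ABw i.+1.
  by rewrite /N leq_max ltn_ord orbT.
by rewrite ltn_ord.
Qed.

Lemma probability_EFin A : measurable A -> P A = (fine (P A))%:E.
Proof. by move=> mA; rewrite fineK// fin_num_measure. Qed.

Let measurable_hp d' (T : measurableType d') (Y : nat -> {mfun Om >-> T}) h m
    (B : set (m.-tuple T)) :
  measurable B -> measurable (hypothesis h `&` past Y m @^-1` B).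
Proof.
move=> mB; apply: measurableI; first exact: measurable_hypothesis.
exact: measurable_past_preimage.
Qed.

(** Conditional independence extends from boxes to all events of O2, then to all
    events of O1. *)
Let past_indep_box h t n (A : nat -> set T1) (B : set (n.-tuple T2)) :
  (forall s, measurable (A s)) -> measurable B ->
  let box := past Y1 t @^-1` [set x | forall i : 'I_t, A i (tnth x i)] in
  P (hypothesis h) * P (hypothesis h `&` box `&` past Y2 n @^-1` B) =
  P (hypothesis h `&` box) * P (hypothesis h `&` past Y2 n @^-1` B).
Proof.
move=> mA mB box; have [_ df1 df2 _] := model.
have mH := measurable_hypothesis h.
have mHA : measurable (hypothesis h `&` box).
  by apply: measurable_hp; exact: measurable_box.
rewrite (probability_EFin mH) (probability_EFin mHA).
apply: (@tuple_law_unique _ _ _ P _ _ _ (past Y2 n)) => //;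
  try by rewrite fine_ge0.
  exact: measurable_past.
move=> C mC; rewrite -(probability_EFin mH) -(probability_EFin mHA).
have lawA n' C' (mC' : forall s, measurable (C' s)) :=
  @box_law h t n' (A \o predn) (C' \o predn) (fun s => mA s.-1)
    (fun s => mC' s.-1).
have [rA rA0 rAE] := density_box_fin h t df1 (fun s => mA s.-1).
have [rC rC0 rCE] := density_box_fin h n df2 (fun s => mC s.-1).
have -> : P (hypothesis h `&` box `&`
    past Y2 n @^-1` [set x | forall i : 'I_n, C i (tnth x i)]) =
    P (hypothesis h) * (rA%:E * rC%:E).
  by rewrite -rAE -rCE -lawA.
have -> : P (hypothesis h `&` box) = P (hypothesis h) * rA%:E.
  have := lawA 0%N _ mC; rewrite (_ : _ @^-1` [set x | forall i : 'I_0, _] = setT).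
    rewrite setIT => ->; rewrite density_box0 mule1.
    by congr (_ * _); rewrite -rAE.
  by apply/seteqP; split=> // x _ /= -[].
have -> : P (hypothesis h `&`
    past Y2 n @^-1` [set x | forall i : 'I_n, C i (tnth x i)]) =
    P (hypothesis h) * rC%:E.
  have := @box_law h 0 n (A \o predn) (C \o predn) (fun s => mA s.-1)
    (fun s => mC s.-1).
  rewrite (_ : past Y1 0 @^-1` _ = setT); last by apply/seteqP; split=> // x _ /= -[].
  rewrite setIT => ->; rewrite density_box0 mul1e.
  by congr (_ * _); rewrite -rCE.
by rewrite !muleA; congr (_ * _); rewrite muleAC.
Qed.

Let past_indep h t n (A : set (t.-tuple T1)) (B : set (n.-tuple T2)) :
  measurable A -> measurable B ->
  P (hypothesis h) *
    P (hypothesis h `&` past Y1 t @^-1` A `&` past Y2 n @^-1` B) =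
  P (hypothesis h `&` past Y1 t @^-1` A) * P (hypothesis h `&` past Y2 n @^-1` B).
Proof.
move=> mA mB; have mH := measurable_hypothesis h.
have mHB := measurable_hp Y2 h mB.
rewrite setIAC [RHS]muleC (probability_EFin mH) (probability_EFin mHB).
apply: (@tuple_law_unique _ _ _ P _ _ _ (past Y1 t)) => //;
  try by rewrite fine_ge0.
  exact: measurable_past.
move=> C mC; rewrite -(probability_EFin mH) -(probability_EFin mHB) [RHS]muleC setIAC.
exact: past_indep_box.
Qed.

Lemma cond_indep_integral h t n (A : set (t.-tuple T1)) F :
  measurable A -> measurable_fun [set: n.-tuple T2] F -> (forall x, 0 <= F x) ->
  P (hypothesis h) *
    \int[P]_(w in hypothesis h `&` past Y1 t @^-1` A) F (past Y2 n w) =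
  P (hypothesis h `&` past Y1 t @^-1` A) *
    \int[P]_(w in hypothesis h) F (past Y2 n w).
Proof.
move=> mA mF F0; have mH := measurable_hypothesis h.
have mHA := measurable_hp Y1 h mA.
rewrite (probability_EFin mH) (probability_EFin mHA).
apply: tuple_law_unique_integral => //; try by rewrite fine_ge0.
  exact: measurable_past.
move=> B mB; rewrite -(probability_EFin mH) -(probability_EFin mHA).
by apply: past_indep => //; exact: measurable_box.
Qed.

(** For boxes [A] this is the product formula for [t + 1] observations, and both
    sides are measures in [A]. *)
Lemma next_observation_law h t (A : set (t.-tuple T1)) (C : set T1) :
  measurable A -> measurable C ->
  P (hypothesis h `&` past Y1 t @^-1` A `&` Y1 t.+1 @^-1` C) =
  P (hypothesis h `&` past Y1 t @^-1` A) *
    \int[nu1 t.+1]_(y in C) (f1 t.+1 h y)%:E.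
Proof.
move=> mA mC; have mH := measurable_hypothesis h; have [_ df1 df2 _] := model.
have mYC : measurable (Y1 t.+1 @^-1` C).
  by rewrite -[X in measurable X]setTI; exact: measurable_funP.
have /andP[i0 i1] := density_integral_le1 t.+1 h df1 mC.
have ifin : \int[nu1 t.+1]_(y in C) (f1 t.+1 h y)%:E \is a fin_num.
  by rewrite ge0_fin_numE// (le_lt_trans i1)// ltry.
rewrite setIAC [RHS]muleC -[LHS]mul1e -[X in X * _ = _]/(1%R%:E) -(fineK ifin).
apply: (@tuple_law_unique _ _ _ P _ _ _ (past Y1 t)) => //;
  try by rewrite fine_ge0.
- exact: measurable_past.
- exact: measurableI.
move=> B mB; rewrite mul1e fineK//.
pose B' s := if (s <= t)%N then B s.-1 else C.
have mB' s : measurable (B' s) by rewrite /B'; case: ifP.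
have := @box_law h t.+1 0 B' (fun=> setT) mB' (fun=> measurableT).
rewrite (_ : past Y2 0 @^-1` _ = setT); last by apply/seteqP; split=> // x _ /= -[].
rewrite setIT density_box0 mule1.
rewrite /density_box big_nat_recr//=.
rewrite (_ : past Y1 t.+1 @^-1` _ = Y1 t.+1 @^-1` C `&`
    past Y1 t @^-1` [set x | forall i : 'I_t, B i (tnth x i)]); last first.
  apply/seteqP; split=> w /=.
    move=> h1; split.
      by have := h1 ord_max; rewrite tnth_mktuple /B' /= ltnn.
    move=> i; have := h1 (widen_ord (leqnSn t) i).
    by rewrite !tnth_mktuple /B' /= ltn_ord.
  move=> [h1 h2] i; rewrite tnth_mktuple /B'; case: ifPn => /= it.
    by have := h2 (Ordinal it); rewrite tnth_mktuple.
  have -> : i = t :> nat by apply/eqP; rewrite eqn_leq -ltnS ltn_ord/= leqNgt.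
  exact: h1.
rewrite setIA => ->.
have := @box_law h t 0 (B \o predn) (fun=> setT) (fun s => mB s.-1) (fun=> measurableT).
rewrite (_ : past Y2 0 @^-1` _ = setT); last by apply/seteqP; split=> // x _ /= -[].
rewrite setIT density_box0 mule1 => ->.
rewrite [RHS]muleCA; congr (_ * _).
rewrite [RHS]muleC; congr (_ * _); last by rewrite /B' ltnn.
by apply: eq_big_nat => s /andP[_]; rewrite ltnS /B' => ->.
Qed.

(** * The belief of O1 *)

Context (pi : forall t : nat, t.-tuple T1 -> R).
Hypothesis belief : is_belief1 P H Y1 pi.
Let mH h : measurable (hypothesis h) := measurable_hypothesis h.
Let mX t B (mB : measurable B) : measurable (past Y1 t @^-1` B) :=
  measurable_past_preimage Y1 mB.

(** A version of a conditional probability may leave [[0, 1]] on a null set only: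
    the integrals of [- pi] over the event [pi < 0] and of [pi - 1] over the
    event [1 < pi] are nonpositive. *)
Lemma belief_in01 t : (0 < t)%N ->
  P (past Y1 t @^-1` [set x | ~~ (0 <= pi x <= 1)%R]) = 0.
Proof.
move=> t0; have [mpi ipi pE] := belief t0.
have mlt0 : measurable [set x : t.-tuple T1 | (pi x < 0)%R].
  rewrite (_ : [set _ | _] = setT `&` @pi t @^-1` `]-oo, 0%R[%classic); first exact: mpi.
  by rewrite setTI; apply/seteqP; split=> x /=; rewrite in_itv.
have mgt1 : measurable [set x : t.-tuple T1 | (1 < pi x)%R].
  rewrite (_ : [set _ | _] = setT `&` @pi t @^-1` `]1%R, +oo[%classic); first exact: mpi.
  by rewrite setTI; apply/seteqP; split=> x /=; rewrite in_itv/= andbT.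
have mpiX : measurable_fun setT (fun w => pi (past Y1 t w)).
  by apply: (measurableT_comp mpi); exact: measurable_past.
have Plt0 : P (past Y1 t @^-1` [set x | (pi x < 0)%R]) = 0.
  apply: (@null_of_integral_le0 _ _ _ _ _ (fun w => - pi (past Y1 t w))%R).
  - exact: mX.
  - by apply: measurable_funTS; apply/measurable_EFinP; exact: measurable_funN.
  - by move=> w /= ?; rewrite oppr_gt0.
  under eq_integral do rewrite EFinN.
  rewrite integralN; last first.
    exact: integrable_add_def (mX mlt0) _
      (integrableS measurableT (mX mlt0) (@subsetT _ _) ipi).
  by rewrite pE// oppe_le0 measure_ge0.
have Pgt1 : P (past Y1 t @^-1` [set x | (1 < pi x)%R]) = 0.
  apply: (@null_of_integral_le0 _ _ _ _ _ (fun w => pi (past Y1 t w) - 1)%R).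
  - exact: mX.
  - by apply: measurable_funTS; apply/measurable_EFinP; exact: measurable_funB.
  - by move=> w /= ?; rewrite subr_gt0.
  under eq_integral do rewrite EFinB.
  rewrite integralB//; [|exact: mX|
    exact: integrableS measurableT (mX mgt1) (@subsetT _ _) ipi|]; last first.
    apply: (integrableS measurableT) => //; first exact: mX.
    apply/integrableP; split => //.
    by rewrite integral_cst//= normr1 mul1e ltey_eq fin_num_measure.
  rewrite pE// integral_cst ?mul1e; last exact: mX.
  rewrite sube_le0; apply: le_measure; rewrite ?inE//; last exact: mX.
  by apply: measurableI; [exact: (mH _)|exact: mX].
have E : [set x : t.-tuple T1 | ~~ (0 <= pi x <= 1)%R] =
    [set x | (pi x < 0)%R] `|` [set x | (1 < pi x)%R].
  apply/seteqP; split=> x /=; rewrite negb_and -!ltNge.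
    by move/orP.
  by move=> h; apply/orP.
apply/eqP; rewrite -measure_le0 E preimage_setU -[leRHS]adde0.
rewrite -[X in (_ <= X + _)]Plt0 -[X in (_ <= _ + X)]Pgt1.
by apply: measureU2; exact: mX.
Qed.

(** Correcting the belief on a null set keeps the weights of both hypotheses
    nonnegative everywhere. *)
Definition clipped t (x : t.-tuple T1) : R := Num.max 0%R (Num.min 1%R (pi x)).

Lemma clipped01 t (x : t.-tuple T1) : (0 <= clipped x <= 1)%R.
Proof. by rewrite /clipped le_max lexx/= ge_max ler01 ge_min lexx. Qed.

Lemma clipped_id t (x : t.-tuple T1) : (0 <= pi x <= 1)%R -> clipped x = pi x.
Proof. by move=> /andP[x0 x1]; rewrite /clipped (min_idPr x1) (max_idPr x0). Qed.

Lemma measurable_clipped t : (0 < t)%N -> measurable_fun setT (@clipped t).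
Proof.
move=> t0; have [mpi _ _] := belief t0.
by apply: measurable_maxr => //; exact: measurable_minr.
Qed.

(** The posterior probability of [h] when that of [H = 0] is [p]. *)
Definition weight (h : bool) (p : R) : R := if h then (1 - p)%R else p.

Lemma weight_ge0 h t (x : t.-tuple T1) : (0 <= weight h (clipped x))%R.
Proof. by have /andP[] := clipped01 x; case: h => //=; rewrite subr_ge0. Qed.

Lemma measurable_weight h t : (0 < t)%N ->
  measurable_fun setT (fun x : t.-tuple T1 => weight h (clipped x)).
Proof.
move=> t0; have mc := measurable_clipped t0.
by case: h => //=; exact: measurable_funB.
Qed.

Lemma integral_weight h t (B : set (t.-tuple T1)) : (0 < t)%N -> measurable B ->
  \int[P]_(w in past Y1 t @^-1` B) (weight h (clipped (past Y1 t w)))%:E =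
  P (hypothesis h `&` past Y1 t @^-1` B).
Proof.
move=> t0 mB; have [mpi ipi pE] := belief t0; have mc := measurable_clipped t0.
have mcX D : measurable_fun D (fun w => (clipped (past Y1 t w))%:E).
  by apply: measurable_funTS; apply/measurable_EFinP/(measurableT_comp mc);
    exact: measurable_past.
have e0 : \int[P]_(w in past Y1 t @^-1` B) (clipped (past Y1 t w))%:E =
    P (hypothesis false `&` past Y1 t @^-1` B).
  rewrite -pE//; apply: ae_eq_integral => //; first exact: mX.
    by apply: measurable_funTS; apply/measurable_EFinP/(measurableT_comp mpi);
      exact: measurable_past.
  exists (past Y1 t @^-1` [set x | ~~ (0 <= pi x <= 1)%R]); split.
  - apply: mX; rewrite (_ : [set _ | _] = setT `&` @pi t @^-1` ~` `[0%R, 1%R]%classic).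
      by apply: mpi => //; exact: measurableC.
    by rewrite setTI; apply/seteqP; split=> x /=; rewrite in_itv/= => /negP.
  - exact: belief_in01.
  - move=> w /=; apply: contra_notN => /clipped_id E _; by rewrite E.
case: h => //=; under eq_integral do rewrite EFinB.
have ic : P.-integrable (past Y1 t @^-1` B) (fun w => (clipped (past Y1 t w))%:E).
  apply/integrableP; split => //.
  apply: (@le_lt_trans _ _ (\int[P]_(w in past Y1 t @^-1` B) cst 1 w)).
    apply: ge0_le_integral => //; [exact: mX|exact: measurableT_comp|].
    move=> w _; have /andP[c0 c1] := clipped01 (past Y1 t w).
    by rewrite /= lee_fin ger0_norm.
  by rewrite integral_cst ?mul1e; [rewrite ltey_eq fin_num_measure//|]; exact: mX.
rewrite integralB//; [|exact: mX|]; last first.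
  apply/integrableP; split => //; rewrite integral_cst; last exact: mX.
  by rewrite /= normr1 mul1e ltey_eq fin_num_measure//; exact: mX.
rewrite integral_cst ?mul1e; last exact: mX.
rewrite e0 [X in X - _](_ : _ = P (hypothesis true `&` past Y1 t @^-1` B) +
    P (hypothesis false `&` past Y1 t @^-1` B)).
  rewrite addeK// fin_num_measure//; apply: measurableI; [exact: (mH _)|exact: mX].
rewrite -measureU//; last 3 first.
- by apply: measurableI; [exact: (mH _)|exact: mX].
- by apply: measurableI; [exact: (mH _)|exact: mX].
- by apply/seteqP; split=> // w [[+ _] [+ _]]; rewrite /hypothesis/= => ->.
congr (P _); rewrite -setIUl; apply/esym/setIidPr => w _ /=.
by rewrite /hypothesis/=; case: (H w); [left|right].
Qed.


(** * Bayes' rule for homogeneous functions of the weights *)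

Local Notation q := clipped.

(** Bayes' rule without its denominator, which the homogeneity of [v]
    absorbs. *)
Definition bayes_step t (v : R -> R -> R) (a b : R) : R :=
  Rintegral (nu1 t.+1) setT
    (fun y => v (a * f1 t.+1 false y) (b * f1 t.+1 true y))%R.

Definition snoc t (z : t.-tuple T1 * T1) : t.+1.-tuple T1 :=
  [tuple of rcons z.1 z.2].

Definition unsnoc t (z : t.+1.-tuple T1) : t.-tuple T1 * T1 :=
  ([tuple tnth z (widen_ord (leqnSn t) i) | i < t], tnth z ord_max).

Let tnth_snoc_widen t (z : t.-tuple T1 * T1) (i : 'I_t) :
  tnth (snoc z) (widen_ord (leqnSn t) i) = tnth z.1 i.
Proof.
rewrite (tnth_nth (tnth z.1 i)) /= nth_rcons size_tuple ltn_ord.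
by rewrite [RHS](tnth_nth (tnth z.1 i)).
Qed.

Let tnth_snoc_max t (z : t.-tuple T1 * T1) : tnth (snoc z) ord_max = z.2.
Proof. by rewrite (tnth_nth z.2) /= nth_rcons size_tuple ltnn eqxx. Qed.

Let snocK t : cancel (@snoc t) (@unsnoc t).
Proof.
move=> [x y]; congr pair; last by rewrite tnth_snoc_max.
by apply: eq_from_tnth => i; rewrite tnth_mktuple tnth_snoc_widen.
Qed.

Let measurable_snoc t : measurable_fun setT (@snoc t).
Proof.
apply/measurable_fun_tnthP => i; have [it|ti] := ltnP i t.
  rewrite (_ : _ \o _ = fun z => tnth z.1 (Ordinal it)).
    by apply: (measurableT_comp (@measurable_tnth _ _ _ _)).
  apply/funext => z /=; rewrite -tnth_snoc_widen; congr tnth; exact: val_inj.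
rewrite (_ : _ \o _ = snd) //; apply/funext => z /=.
rewrite -[RHS]tnth_snoc_max; congr tnth; apply: val_inj => /=.
by apply/eqP; rewrite eqn_leq ti -ltnS ltn_ord.
Qed.

Let measurable_unsnoc t : measurable_fun setT (@unsnoc t).
Proof.
apply/measurable_fun_pairP; split; last exact: measurable_tnth.
apply/measurable_fun_tnthP => i.
rewrite (_ : _ \o _ = fun z => tnth z (widen_ord (leqnSn t) i)).
  exact: measurable_tnth.
by apply/funext => z /=; rewrite tnth_mktuple.
Qed.

Let pastS t w : past Y1 t.+1 w = snoc (past Y1 t w, Y1 t.+1 w).
Proof.
apply: eq_from_tnth => i; rewrite /past tnth_mktuple.
have [it|ti] := ltnP i t.
  have -> : i = widen_ord (leqnSn t) (Ordinal it) by exact: val_inj.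
  by rewrite tnth_snoc_widen tnth_mktuple.
have -> : i = ord_max.
  by apply: val_inj; apply/eqP; rewrite eqn_leq ti -ltnS ltn_ord.
by rewrite tnth_snoc_max.
Qed.

Lemma past_prefix t (B : set (t.-tuple T1)) : measurable B ->
  exists2 B' : set (t.+1.-tuple T1), measurable B' &
    past Y1 t.+1 @^-1` B' = past Y1 t @^-1` B.
Proof.
move=> mB; exists ((fst \o @unsnoc t) @^-1` B).
  rewrite -[X in measurable X]setTI.
  exact: (measurableT_comp measurable_fst (@measurable_unsnoc t)).
by apply/funext => w; rewrite /preimage /mkset /comp pastS snocK.
Qed.

Let pair t w := (past Y1 t w, Y1 t.+1 w).

Let mpair t : measurable_fun setT (pair t).
Proof.
apply/measurable_fun_pairP; split; first exact: measurable_past.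
exact: measurable_funP.
Qed.

Let f1_ge0 t h y : (0 <= f1 t h y)%R.
Proof. by case: model => _ /(_ t h)[]. Qed.

Let mf1 t h : measurable_fun setT (f1 t h).
Proof. by case: model => _ /(_ t h)[]. Qed.

Let int_f1 t h : \int[nu1 t]_y (f1 t h y)%:E = 1.
Proof. by case: model => _ /(_ t h)[]. Qed.

Lemma superlinear_bayes_step t v : superlinear v -> superlinear (bayes_step t v).
Proof.
exact: (superlinear_integral (@mf1 _ false) (@mf1 _ true) (@f1_ge0 _ _)
  (@f1_ge0 _ _) (int_f1 _ _) (int_f1 _ _)).
Qed.

Lemma bayes_step_ge0 t v (a b : R) :
  (forall a b : R, 0 <= a -> 0 <= b -> 0 <= v a b)%R ->
  (0 <= a)%R -> (0 <= b)%R -> (0 <= bayes_step t v a b)%R.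
Proof. by move=> v0 a0 b0; apply: Rintegral_ge0 => y _; rewrite v0// mulr_ge0. Qed.

Let mpast t : measurable_fun setT (past Y1 t).
Proof. exact: measurable_past. Qed.

Let pastX t : {mfun Om >-> t.-tuple T1} :=
  HB.pack (past Y1 t) (isMeasurableFun.Build _ _ _ _ _ (@mpast t)).
Arguments pastX : clear implicits.

Local Notation mu t := (distribution P (pastX t)).

Let integral_mu t B (F : t.-tuple T1 -> R) : measurable B ->
  measurable_fun setT F -> (forall x, 0 <= F x)%R ->
  \int[mu t]_(x in B) (F x)%:E = \int[P]_(w in past Y1 t @^-1` B) (F (past Y1 t w))%:E.
Proof.
move=> mB mF F0; rewrite ge0_integral_pushforward//.
  by apply: measurable_funTS; exact/measurable_EFinP.
by move=> x _; rewrite lee_fin.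
Qed.

(** Under each hypothesis the next observation is independent of the past, so
    the joint law has a product density. *)
Let pair_law h t A : (0 < t)%N -> measurable A ->
  P (hypothesis h `&` pair t @^-1` A) =
  \int[mu t \x nu1 t.+1]_(z in A) (weight h (q z.1) * f1 t.+1 h z.2)%:E.
Proof.
move=> t0 mA; have mw := measurable_weight h t0.
have [m [mE _]] := restricted_law P (@mpair t) (measurable_hypothesis h) ler01.
have wE B : measurable B -> \int[mu t]_(x in B) (weight h (q x))%:E =
    P (hypothesis h `&` past Y1 t @^-1` B).
  move=> mB; rewrite integral_mu//; last by move=> x; exact: weight_ge0.
  exact: integral_weight.
rewrite -[LHS]mul1e -mE//.
apply: (@product_density_unique _ _ _ _ _ (mu t) (nu1 t.+1)
  (fun x => weight h (q x)) (f1 t.+1 h)) => //.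
- by move=> x; exact: weight_ge0.
- rewrite wE// ltey_eq fin_num_measure//; apply: measurableI.
    exact: measurable_hypothesis.
  exact: measurable_past_preimage.
- by rewrite int_f1 ltry.
- move=> B C mB mC; rewrite mE ?mul1e; last exact: measurableX.
  rewrite wE// -next_observation_law// -setIA; congr (P (_ `&` _)).
Qed.

(** The joint laws of the past and the next observation under the two hypotheses
    have two pairs of densities: the next belief and its complement, with respect
    to their sum, and the current weights times the likelihoods, with respect to
    a product measure; [integral_homogeneous] compares the two integrals. *)
Lemma integral_bayes_step t v (B : set (t.-tuple T1)) : (0 < t)%N ->
  superlinear v -> (forall a b : R, 0 <= a -> 0 <= b -> 0 <= v a b)%R ->
  measurable B ->
  \int[P]_(w in past Y1 t @^-1` B)
    (v (q (past Y1 t.+1 w)) (1 - q (past Y1 t.+1 w)))%:E =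
  \int[P]_(w in past Y1 t @^-1` B)
    (bayes_step t v (q (past Y1 t w)) (1 - q (past Y1 t w)))%:E.
Proof.
move=> t0 sv v0 mB.
have [m mE] := product_sigma_finite (mu t) (nu1 t.+1).
have int_m A (F : (t.-tuple T1 * T1)%type -> \bar R) :
    \int[m]_(z in A) F z = \int[mu t \x nu1 t.+1]_(z in A) F z.
  by apply: eq_measure_integral => C _ _; exact: mE.
pose X : {mfun Om >-> (t.-tuple T1 * T1)%type} :=
  HB.pack (pair t) (isMeasurableFun.Build _ _ _ _ _ (@mpair t)).
pose p (z : (t.-tuple T1 * T1)%type) : R := q (snoc z).
have mq s : (0 < s)%N -> measurable_fun setT (clipped (t := s)).
  exact: measurable_clipped.
have mp : measurable_fun setT p.
  exact: (measurableT_comp (mq _ (ltn0Sn t)) (@measurable_snoc t)).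
have p01 z : (0 <= p z <= 1)%R by exact: clipped01.
have wq h (x : t.-tuple T1) : (0 <= weight h (q x))%R by exact: weight_ge0.
pose g h (z : (t.-tuple T1 * T1)%type) : R := (weight h (q z.1) * f1 t.+1 h z.2)%R.
have mg h : measurable_fun setT (g h).
  apply: measurable_funM.
    exact: (measurableT_comp (measurable_weight h t0) measurable_fst).
  exact: (measurableT_comp (@mf1 t.+1 h) measurable_snd).
have g0 h z : (0 <= g h z)%R by rewrite mulr_ge0.
have law h A : measurable A ->
    \int[distribution P X]_(z in A) (weight h (p z))%:E = \int[m]_(z in A) (g h z)%:E.
  move=> mA; rewrite int_m -pair_law// ge0_integral_pushforward//; last 2 first.
  - apply: measurable_funTS; apply/measurable_EFinP.
    exact: (measurableT_comp (measurable_weight h (ltn0Sn t)) (@measurable_snoc t)).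
  - by move=> z _; rewrite lee_fin; exact: weight_ge0.
  have -> : pair t @^-1` A = past Y1 t.+1 @^-1` (@unsnoc t @^-1` A).
    by apply/funext => w; rewrite /preimage/= pastS snocK.
  rewrite -(integral_weight h (ltn0Sn t))//; last first.
    by rewrite -[X in measurable X]setTI; exact: (measurable_unsnoc measurableT mA).
  by apply: eq_integral => w _; rewrite /p /= pastS.
have hom : forall c a b, (0 <= c)%R -> (v (c * a) (c * b) = c * v a b)%R.
  by case: sv.
have mBT : measurable (B `*` [set: T1]) by exact: measurableX.
have mvp : measurable_fun setT (fun z => v (p z) (1 - p z)%R).
  by apply: superlinear_measurable => //; exact: measurable_funB.
have mvg := superlinear_measurable sv (mg false) (mg true).
have key := @integral_homogeneous _ _ _ m (distribution P X) p (g false) (g true) v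
  mp (mg false) (mg true) p01 (g0 false) (g0 true) (law false) (law true) hom v0
  mvp mvg _ mBT.
transitivity (\int[distribution P X]_(z in B `*` [set: T1]) (v (p z) (1 - p z))%:E).
  rewrite ge0_integral_pushforward//; last 2 first.
  - by apply: measurable_funTS; exact/measurable_EFinP.
  - move=> z _; have /andP[p0' p1'] := p01 z.
    by rewrite lee_fin v0// subr_ge0.
  have -> : (X : Om -> _) @^-1` (B `*` setT) = past Y1 t @^-1` B.
    by apply/seteqP; split=> w /= => [[]|].
  by apply: eq_integral => w _; rewrite /p /= pastS.
rewrite key int_m integral_mkcond fubini_tonelli1; last 2 first.
- apply/(measurable_restrictT _ _).1 => //.
  by apply: measurable_funTS; exact/measurable_EFinP.
- by move=> z; apply: erestrict_ge0 => ? _; rewrite lee_fin v0.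
have sb := superlinear_bayes_step t sv.
have q0 (x : t.-tuple T1) : (0 <= q x)%R by exact: (wq false x).
have q1 (x : t.-tuple T1) : (0 <= 1 - q x)%R by exact: (wq true x).
rewrite -(integral_mu mB (F := fun x => bayes_step t v (q x) (1 - q x)%R)); last 2 first.
- apply: superlinear_measurable => //; first exact: mq.
  by apply: measurable_funB => //; exact: mq.
- by move=> x; exact: bayes_step_ge0.
rewrite [RHS]integral_mkcond; apply: eq_integral => x _; rewrite /fubini_F patchE.
have [xB|xB] := boolP (x \in B); last first.
  by rewrite integral0_eq// => y _; rewrite patchE in_setX (negbTE xB).
rewrite /bayes_step /Rintegral fineK.
  by apply: eq_integral => y _; rewrite patchE in_setX xB in_setT.
apply: integrable_fin_num => //.
exact: (superlinear_integrable (@mf1 _ false) (@mf1 _ true) (@f1_ge0 _ _)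
  (@f1_ge0 _ _) (int_f1 _ _) (int_f1 _ _)).
Qed.

(** * Expected costs given the hypothesis *)

Context (c1 c2 L : R) (J : bool -> bool -> R).
Hypotheses (c1_gt0 : (0 < c1)%R) (c2_gt0 : (0 < c2)%R)
  (J_bounds : forall u h, (0 <= J u h <= L)%R).
Context (G2 : policy2 T2) (n : nat).
Hypotheses (G2_meas : measurable_policy2 G2) (G2_finite : finite_horizon G2 n).

Let c1_ge0 : (0 <= c1)%R. Proof. exact: ltW. Qed.
Let c2_ge0 : (0 <= c2)%R. Proof. exact: ltW. Qed.

Let stage2 h (s : nat) (u : bool) : \bar R := (c2 * s%:R + J u h)%:E.

Let cost2E z w : cost2 H Y2 c2 J G2 z w =
  first_stop (stage2 (H w)) 0 (actions2 G2 (Y2 ^~ w) z) n 1.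
Proof.
have [t st tn] := G2_finite (Y2 ^~ w) z; rewrite /cost2 /final_action st /=.
have /stop_timeP[t0 at0 _] := st.
case E: (actions2 G2 (Y2 ^~ w) z t) at0 => [u|//] _.
by rewrite (first_stopE _ _ st E)// EFinD EFinM.
Qed.

Let cost2_received z z' w : (forall r, (r <= n)%N -> received z r = received z' r) ->
  cost2 H Y2 c2 J G2 z w = cost2 H Y2 c2 J G2 z' w.
Proof.
move=> zz'; rewrite !cost2E; apply: eq_first_stop => r /andP[_ rn].
by rewrite /actions2 zz'.
Qed.

Let cost2_bounds z w : 0 <= cost2 H Y2 c2 J G2 z w <= (c2 * n%:R + L)%:E.
Proof.
have L0 : (0 <= L)%R by have /andP[] := J_bounds true true; exact: le_trans.
rewrite cost2E; apply: (first_stop_ind (Q := fun x => 0 <= x <= (c2 * n%:R + L)%:E)).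
  by rewrite lexx lee_fin addr_ge0// mulr_ge0.
move=> r u /andP[_ rn]; have /andP[J0 JL] := J_bounds u (H w).
rewrite !lee_fin addr_ge0 ?mulr_ge0//= lerD// ler_wpM2l// ler_nat.
by rewrite -ltnS.
Qed.

Let cost2_ge0 z w : 0 <= cost2 H Y2 c2 J G2 z w.
Proof. by have /andP[] := cost2_bounds z w. Qed.

(** [y0] is a dummy: O2 stops by time [n], before it is read. *)
Let extend (y0 : T2) (x : n.-tuple T2) : nat -> T2 := fun i => nth y0 x i.-1.

Let hist_extend y0 w s : (s <= n)%N ->
  hist (extend y0 (past Y2 n w)) s = hist (Y2 ^~ w) s.
Proof.
move=> sn; apply: eq_from_tnth => i; rewrite !tnth_mktuple /extend /=.
have in_ : (i < n)%N by exact: leq_trans (ltn_ord i) sn.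
by have /= <- := tnth_nth y0 (past Y2 n w) (Ordinal in_); rewrite tnth_mktuple.
Qed.

Let measurable_hist_extend y0 s :
  measurable_fun [set: n.-tuple T2] (fun x => hist (extend y0 x) s).
Proof.
apply/measurable_fun_tnthP => i; have [in_|ni] := ltnP i n.
  rewrite (_ : _ \o _ = fun x => tnth x (Ordinal in_)); first exact: measurable_tnth.
  by apply/funext => x /=; rewrite tnth_mktuple /extend (tnth_nth y0).
rewrite (_ : _ \o _ = cst y0); first exact: measurable_cst.
by apply/funext => x /=; rewrite tnth_mktuple /extend nth_default// size_tuple.
Qed.

(** The costs after O1's message as a function of the first [n] observations of
    O2 and of the hypothesis, the form in which conditional independence
    applies. *)
Let record_cost (y0 : T2) z h (x : n.-tuple T2) : \bar R :=
  first_stop (stage2 h) 0 (actions2 G2 (extend y0 x) z) n 1.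

Let measurable_record_cost y0 z h : measurable_fun setT (record_cost y0 z h).
Proof.
apply: (@measurable_first_stop _ _ _ (fun=> stage2 h) (fun=> 0)) => //.
move=> r u; rewrite -[X in measurable X]setTI.
exact: (measurable_hist_extend y0 (s := r) measurableT (G2_meas (received z r) u)).
Qed.

Let record_cost_ge0 y0 z h x : 0 <= record_cost y0 z h x.
Proof.
apply: (first_stop_ind (Q := fun x => 0 <= x)) => // r u _.
have /andP[J0 _] := J_bounds u h.
by rewrite lee_fin addr_ge0// mulr_ge0.
Qed.

Let cost2_record y0 z w : cost2 H Y2 c2 J G2 z w = record_cost y0 z (H w) (past Y2 n w).
Proof.
rewrite cost2E; apply: eq_first_stop => r /andP[_ rn].
by rewrite /actions2 hist_extend.
Qed.

Let inhabited2 : exists y0 : T2, True.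
Proof.
have [w _] : [set: Om] !=set0.
  apply/set0P/eqP => T0; have := @probability_setT _ _ _ P.
  by rewrite T0 measure0 => /esym/eqP; rewrite onee_eq0.
by exists (Y2 0%N w).
Qed.

Let measurable_cost2 z : measurable_fun setT (cost2 H Y2 c2 J G2 z).
Proof.
have [y0 _] := inhabited2.
rewrite (_ : cost2 _ _ _ _ _ _ = fun w => if H w
    then record_cost y0 z true (past Y2 n w)
    else record_cost y0 z false (past Y2 n w)); last first.
  by apply/funext => w; rewrite (cost2_record y0); case: (H w).
apply: measurable_fun_ifT; first exact: measurable_funP.
  exact: (measurableT_comp (@measurable_record_cost y0 z true)
    (@measurable_past _ _ Y2 n)).
exact: (measurableT_comp (@measurable_record_cost y0 z false)
  (@measurable_past _ _ Y2 n)).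
Qed.

(** This is [cond_cost2] for an arbitrary sequence of messages [z], as a real
    number. *)
Let mean_cost2 (z : nat -> action) (h : bool) : R :=
  fine (((fine (P (hypothesis h)))^-1)%:E *
    \int[P]_(w in hypothesis h) cost2 H Y2 c2 J G2 z w).

Let int_cost2_fin D z : measurable D ->
  \int[P]_(w in D) cost2 H Y2 c2 J G2 z w \is a fin_num.
Proof.
move=> mD; rewrite ge0_fin_numE; last by apply: integral_ge0 => w _.
apply: (@le_lt_trans _ _ (\int[P]_(w in D) (cst (c2 * n%:R + L)%:E w))).
  apply: ge0_le_integral => //; first exact: measurable_funTS.
  by move=> w _; have /andP[] := cost2_bounds z w.
by rewrite integral_cst// ltey_eq fin_numM// fin_num_measure.
Qed.

Let mean_cost2_ge0 z h : (0 <= mean_cost2 z h)%R.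
Proof.
apply: fine_ge0; apply: mule_ge0; first by rewrite lee_fin invr_ge0 fine_ge0.
by apply: integral_ge0.
Qed.

Let cond_cost2E t u h :
  cond_cost2 P H Y2 c2 J G2 t u h = (mean_cost2 (message t u) h)%:E.
Proof. by rewrite /mean_cost2 fineK// fin_numM// int_cost2_fin. Qed.

(** By conditional independence, what O1 has observed matters for the costs of
    O2 only through the probability of [h]; a hypothesis of probability zero
    makes both sides vanish. *)
Let integral_cost2 h t z (B : set (t.-tuple T1)) : measurable B ->
  \int[P]_(w in hypothesis h `&` past Y1 t @^-1` B) cost2 H Y2 c2 J G2 z w =
  P (hypothesis h `&` past Y1 t @^-1` B) * (mean_cost2 z h)%:E.
Proof.
move=> mB; have [y0 _] := inhabited2.
have mHB : measurable (hypothesis h `&` past Y1 t @^-1` B).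
  by apply: measurableI => //; exact: mX.
have := cond_indep_integral h mB (@measurable_record_cost y0 z h)
  (@record_cost_ge0 y0 z h).
have toF D : D `<=` hypothesis h ->
    \int[P]_(w in D) record_cost y0 z h (past Y2 n w) =
    \int[P]_(w in D) cost2 H Y2 c2 J G2 z w.
  move=> DH; apply: eq_integral => w /[!inE] /DH Hw.
  by rewrite (cost2_record y0) Hw.
rewrite !toF//.
rewrite /mean_cost2 fineK ?fin_numM ?int_cost2_fin//.
rewrite (probability_EFin (mH h)).
have [P0 _|Pn0] := eqVneq (fine (P (hypothesis h))) 0%R.
  have PB0 : P (hypothesis h `&` past Y1 t @^-1` B) = 0.
    apply/eqP; rewrite -measure_le0; apply: (@le_trans _ _ (P (hypothesis h))).
      by apply: le_measure; rewrite ?inE//; exact: subIsetl.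
    by rewrite (probability_EFin (mH h)) P0.
  by rewrite PB0 mul0e null_set_integral//; exact: measurable_funTS.
by move=> E; rewrite muleCA -E muleA -EFinM mulVf// mul1e.
Qed.

(** The expected cost when O1 sends [z] and pays until time [s], as a linear
    function of the weights of the hypotheses. *)
Let stop_cost (s : nat) (z : nat -> action) (a b : R) : R :=
  (a * (c1 * s%:R + mean_cost2 z false) + b * (c1 * s%:R + mean_cost2 z true))%R.

Let pay (s : nat) (z : nat -> action) (w : Om) : \bar R :=
  (c1 * s%:R)%:E + cost2 H Y2 c2 J G2 z w.

Let pay_ge0 s z w : 0 <= pay s z w.
Proof. by rewrite adde_ge0// lee_fin mulr_ge0. Qed.

Let measurable_pay s z : measurable_fun setT (pay s z).
Proof. exact: emeasurable_funD. Qed.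

Let integral_pay r t z (B : set (t.-tuple T1)) : (0 < t)%N -> measurable B ->
  \int[P]_(w in past Y1 t @^-1` B) pay r z w =
  \int[P]_(w in past Y1 t @^-1` B)
    (stop_cost r z (q (past Y1 t w)) (1 - q (past Y1 t w)))%:E.
Proof.
move=> t0 mB; have mXB := mX mB.
have mHB h : measurable (hypothesis h `&` past Y1 t @^-1` B) by exact: measurableI.
have mw h : measurable_fun setT (fun w => (weight h (q (past Y1 t w)))%:E).
  apply/measurable_EFinP.
  exact: (measurableT_comp (measurable_weight h t0) (@measurable_past _ _ Y1 t)).
have k0 h : (0 <= c1 * r%:R + mean_cost2 z h)%R by rewrite addr_ge0// mulr_ge0.
have byH h : \int[P]_(w in hypothesis h `&` past Y1 t @^-1` B) pay r z w =
    \int[P]_(w in past Y1 t @^-1` B)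
      ((c1 * r%:R + mean_cost2 z h)%:E * (weight h (q (past Y1 t w)))%:E).
  rewrite ge0_integralD//; last by exact: measurable_funTS.
  rewrite integral_cst// integral_cost2// ge0_integralZl//.
  - rewrite integral_weight// EFinD muleC.
    by rewrite -ge0_muleDr ?lee_fin ?mulr_ge0// muleC.
  - exact: measurable_funTS.
  - by move=> w _; rewrite lee_fin; exact: weight_ge0.
  - by rewrite lee_fin.
  - by move=> w _; rewrite lee_fin mulr_ge0.
have XE : past Y1 t @^-1` B = (hypothesis false `&` past Y1 t @^-1` B) `|`
    (hypothesis true `&` past Y1 t @^-1` B).
  rewrite -setIUl; apply/esym/setIidPr => w _ /=.
  by rewrite /hypothesis/=; case: (H w); [right|left].
have mkw h : measurable_fun (past Y1 t @^-1` B)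
    (fun w => (c1 * r%:R + mean_cost2 z h)%:E * (weight h (q (past Y1 t w)))%:E).
  by apply: measurable_funTS; exact: measurable_funeM.
have kw0 h w : 0 <= (c1 * r%:R + mean_cost2 z h)%:E * (weight h (q (past Y1 t w)))%:E.
  by rewrite mule_ge0// lee_fin//; exact: weight_ge0.
rewrite [in LHS]XE ge0_integral_setU//; last 2 first.
- exact: measurable_funTS.
- by apply/disj_setPS => w [[+ _] [+ _]]; rewrite /hypothesis/= => ->.
rewrite !byH -ge0_integralD//.
by apply: eq_integral => w _; rewrite -!EFinM -EFinD /stop_cost /weight; congr EFin; ring.
Qed.

Let superlinear_stop_cost s z : superlinear (stop_cost s z).
Proof. exact: superlinear_linear. Qed.

Let stop_cost_ge0 s z a b : (0 <= a)%R -> (0 <= b)%R -> (0 <= stop_cost s z a b)%R.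
Proof.
by move=> a0 b0; rewrite /stop_cost addr_ge0// mulr_ge0// addr_ge0// mulr_ge0.
Qed.

(** * Backward induction *)

(** The least expected cost from time [s = n + 1 - k] on.  At time [n + 1] O2 has
    stopped and O1 gains nothing by waiting; the message is then irrelevant, so
    that silence is as good. *)
Let value := fix value k s : R -> R -> R :=
  if k is k'.+1 then fun a b =>
    Num.min (Num.min (stop_cost s (message s false) a b)
        (stop_cost s (message s true) a b))
      (bayes_step s (value k' s.+1) a b)
  else stop_cost n.+1 silence.

Let superlinear_value k s : superlinear (value k s).
Proof.
elim: k s => [|k IH] s /=; first exact: superlinear_stop_cost.
apply: superlinear_min; first exact: superlinear_min.
exact: superlinear_bayes_step.
Qed.

Let value_ge0 k s a b : (0 <= a)%R -> (0 <= b)%R -> (0 <= value k s a b)%R.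
Proof.
elim: k s a b => [|k IH] s a b a0 b0 /=; first exact: stop_cost_ge0.
rewrite !le_min !stop_cost_ge0//=; apply: bayes_step_ge0 => // a' b'.
exact: IH.
Qed.

Let value_at k s t w : R := value k s (q (past Y1 t w)) (1 - q (past Y1 t w))%R.

(** The cost of the policy [G] stopped at time [n + 1], where [s = n + 1 - k] is
    the first time at which it may send a message. *)
Let policy_cost (G : policy1 T1) k s w : \bar R :=
  first_stop (fun r u => pay r (message r u) w) (pay n.+1 silence w)
    (messages1 G (Y1 ^~ w)) k s.

Let policy_cost_ge0 G k s w : 0 <= policy_cost G k s w.
Proof. by apply: (first_stop_ind (Q := fun x => 0 <= x)). Qed.

Let measurable_messages G r u : measurable_policy1 G ->
  measurable [set w | messages1 G (Y1 ^~ w) r = u].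
Proof. by move=> mG; exact: (mX (mG r u)). Qed.

Let measurable_policy_cost G k s : measurable_policy1 G ->
  measurable_fun setT (policy_cost G k s).
Proof.
move=> mG; apply: (@measurable_first_stop _ _ _ (fun w r u => pay r (message r u) w)
  (pay n.+1 silence)) => //.
by move=> r u; exact: measurable_messages.
Qed.

Let integral_split3 (G : policy1 T1) s (B : set (s.-tuple T1)) (F : Om -> \bar R) :
  measurable_policy1 G -> measurable B -> measurable_fun setT F ->
  (forall w, 0 <= F w) ->
  let I u := \int[P]_(w in past Y1 s @^-1` (B `&` [set x | G s x = u])) F w in
  \int[P]_(w in past Y1 s @^-1` B) F w = I (Some false) + I (Some true) + I None.
Proof.
move=> mG mB mF F0 I.
have mD u : measurable (past Y1 s @^-1` (B `&` [set x | G s x = u])).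
  by apply: mX; apply: measurableI => //; exact: mG.
have -> : past Y1 s @^-1` B =
    (past Y1 s @^-1` (B `&` [set x | G s x = Some false]) `|`
     past Y1 s @^-1` (B `&` [set x | G s x = Some true])) `|`
    past Y1 s @^-1` (B `&` [set x | G s x = None]).
  apply/seteqP; split=> w /=; last by move=> [[[]|[]]|[]].
  by move=> Bw; case: (G s (past Y1 s w)) => [[]|]; [left; right|left; left|right].
rewrite ge0_integral_setU//; [|exact: measurableU|exact: measurable_funTS|]; last first.
  by apply/disj_setPS => w [[[_ /= ->]|[_ /= ->]] [_ /=]].
rewrite ge0_integral_setU//; first exact: measurable_funTS.
by apply/disj_setPS => w [[_ /= ->] [_ /=]].
Qed.

Let measurable_value_at k s t : (0 < t)%N ->
  measurable_fun setT (fun w => (value_at k s t w)%:E).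
Proof.
move=> t0; apply/measurable_EFinP.
have mw h := measurableT_comp (measurable_weight h t0) (@measurable_past _ _ Y1 t).
exact: (superlinear_measurable (superlinear_value k s) (mw false) (mw true)).
Qed.

Let value_at_ge0 k s t w : 0 <= (value_at k s t w)%:E.
Proof.
have /andP[q0 q1] := clipped01 (past Y1 t w).
by rewrite lee_fin value_ge0// subr_ge0.
Qed.
Let stop_at s u t w : R :=
  stop_cost s (message s u) (q (past Y1 t w)) (1 - q (past Y1 t w))%R.

Let wait_at k s w : R :=
  bayes_step s (value k s.+1) (q (past Y1 s w)) (1 - q (past Y1 s w))%R.

Let value_atS k s w : value_at k.+1 s s w =
  Num.min (Num.min (stop_at s false s w) (stop_at s true s w)) (wait_at k s w).
Proof. by []. Qed.

Let policy_cost_step G k s (B : set (s.-tuple T1)) : measurable_policy1 G ->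
  (0 < s)%N -> measurable B ->
  let D u := past Y1 s @^-1` (B `&` [set x | G s x = u]) in
  \int[P]_(w in past Y1 s @^-1` B) policy_cost G k.+1 s w =
  \int[P]_(w in D (Some false)) (stop_at s false s w)%:E +
  \int[P]_(w in D (Some true)) (stop_at s true s w)%:E +
  \int[P]_(w in D None) policy_cost G k s.+1 w.
Proof.
move=> mG s0 mB D; rewrite (integral_split3 mG mB)//; last exact: measurable_policy_cost.
have stopE u : \int[P]_(w in D (Some u)) policy_cost G k.+1 s w =
    \int[P]_(w in D (Some u)) (stop_at s u s w)%:E.
  rewrite -integral_pay//; last by apply: measurableI => //; exact: mG.
  by apply: eq_integral => w /[!inE] -[_ /= GE]; rewrite /policy_cost /= /messages1 GE.
congr (_ + _ + _); [exact: stopE|exact: stopE|].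
by apply: eq_integral => w /[!inE] -[_ /= GE]; rewrite /policy_cost /= {1}/messages1 GE.
Qed.

Let integral_wait k s (B : set (s.-tuple T1)) : (0 < s)%N -> measurable B ->
  \int[P]_(w in past Y1 s @^-1` B) (value_at k s.+1 s.+1 w)%:E =
  \int[P]_(w in past Y1 s @^-1` B) (wait_at k s w)%:E.
Proof.
move=> s0 mB; apply: integral_bayes_step => //.
by move=> a b; exact: value_ge0.
Qed.

Let measurable_stop_at s u t : (0 < t)%N ->
  measurable_fun setT (fun w => (stop_at s u t w)%:E).
Proof.
move=> t0; apply/measurable_EFinP.
have mw h := measurableT_comp (measurable_weight h t0) (@measurable_past _ _ Y1 t).
exact: (superlinear_measurable (superlinear_stop_cost s _) (mw false) (mw true)).
Qed.

Let measurable_wait_at k s : (0 < s)%N ->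
  measurable_fun setT (fun w => (wait_at k s w)%:E).
Proof.
move=> t0; apply/measurable_EFinP.
have mw h := measurableT_comp (measurable_weight h t0) (@measurable_past _ _ Y1 s).
apply: (superlinear_measurable _ (mw false) (mw true)).
exact: superlinear_bayes_step.
Qed.

Let stop_at_ge0 s u t w : 0 <= (stop_at s u t w)%:E.
Proof.
have /andP[q0 q1] := clipped01 (past Y1 t w).
by rewrite lee_fin stop_cost_ge0// subr_ge0.
Qed.

Let wait_at_ge0 k s w : 0 <= (wait_at k s w)%:E.
Proof.
have /andP[q0 q1] := clipped01 (past Y1 s w).
rewrite lee_fin; apply: bayes_step_ge0 => //; last by rewrite subr_ge0.
by move=> a b; exact: value_ge0.
Qed.

Let measurable_piece G s u (B : set (s.-tuple T1)) : measurable_policy1 G ->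
  measurable B -> measurable (past Y1 s @^-1` (B `&` [set x | G s x = u])).
Proof. by move=> mG mB; apply: mX; apply: measurableI => //; exact: mG. Qed.

(** On each of the three events the value is at most the term of the action
    taken there; the term of waiting is carried to time [s + 1] by
    [integral_wait]. *)
Let value_le_policy_cost G k s (B : set (s.-tuple T1)) : measurable_policy1 G ->
  (0 < s)%N -> (s + k)%N = n.+1 -> measurable B ->
  \int[P]_(w in past Y1 s @^-1` B) (value_at k s s w)%:E <=
  \int[P]_(w in past Y1 s @^-1` B) policy_cost G k s w.
Proof.
move=> mG; elim: k s B => [|k IH] s B s0 sk mB.
  by rewrite le_eqVlt /policy_cost integral_pay// eqxx.
rewrite policy_cost_step// (integral_split3 mG mB)//; last exact: measurable_value_at.
have mP u := @measurable_piece G s u B mG mB.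
apply: leeD; [apply: leeD|].
- apply: ge0_le_integral => //.
  + by apply: measurable_funTS; exact: measurable_value_at.
  + by apply: measurable_funTS; exact: measurable_stop_at.
  + by move=> w _; rewrite lee_fin value_atS !ge_min lexx.
- apply: ge0_le_integral => //.
  + by apply: measurable_funTS; exact: measurable_value_at.
  + by apply: measurable_funTS; exact: measurable_stop_at.
  + by move=> w _; rewrite lee_fin value_atS !ge_min lexx orbT.
apply: (@le_trans _ _ (\int[P]_(w in past Y1 s @^-1` (B `&` [set x | G s x = None]))
    (wait_at k s w)%:E)).
  apply: ge0_le_integral => //.
  + by apply: measurable_funTS; exact: measurable_value_at.
  + by apply: measurable_funTS; exact: measurable_wait_at.
  + by move=> w _; rewrite lee_fin value_atS !ge_min lexx orbT.
have mBN : measurable (B `&` [set x | G s x = None]).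
  by apply: measurableI => //; exact: mG.
rewrite -integral_wait//; have [B' mB' <-] := past_prefix mBN.
by apply: IH => //; rewrite addSnnS.
Qed.

(** Almost surely, [G] takes an action that attains the minimum in [value]. *)
Let prescribed (G : policy1 T1) := forall k s, (0 < s)%N -> (s + k.+1)%N = n.+1 ->
  exists N : set Om, [/\ measurable N, P N = 0 &
    forall w, ~ N w ->
      (if G s (past Y1 s w) is Some u then stop_at s u s w else wait_at k s w) <=
      value_at k.+1 s s w]%R.

Let policy_cost_le_value G k s (B : set (s.-tuple T1)) : measurable_policy1 G ->
  prescribed G -> (0 < s)%N -> (s + k)%N = n.+1 -> measurable B ->
  \int[P]_(w in past Y1 s @^-1` B) policy_cost G k s w <=
  \int[P]_(w in past Y1 s @^-1` B) (value_at k s s w)%:E.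
Proof.
move=> mG GV; elim: k s B => [|k IH] s B s0 sk mB.
  by rewrite le_eqVlt /policy_cost integral_pay// eqxx.
rewrite policy_cost_step// [leRHS](integral_split3 mG mB)//; last first.
  exact: measurable_value_at.
have mP u := @measurable_piece G s u B mG mB.
have [N [mN N0 NV]] := GV k s s0 sk.
have aeV (F : Om -> R) D : measurable D -> measurable_fun setT (fun w => (F w)%:E) ->
    (forall w, 0 <= (F w)%:E) ->
    (forall w, D w -> ~ N w -> (F w <= value_at k.+1 s s w)%R) ->
    \int[P]_(w in D) (F w)%:E <= \int[P]_(w in D) (value_at k.+1 s s w)%:E.
  move=> mD mF F0 FV; apply: ae_ge0_le_integral => //.
  - exact: measurable_funTS.
  - by apply: measurable_funTS; exact: measurable_value_at.
  exists N; split=> // w /= /not_implyP[Dw nle]; apply: contrapT => nN.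
  by apply: nle; rewrite lee_fin FV.
apply: leeD; [apply: leeD|].
- apply: aeV => //; first exact: measurable_stop_at.
  by move=> w [_ /= GE] /NV; rewrite GE.
- apply: aeV => //; first exact: measurable_stop_at.
  by move=> w [_ /= GE] /NV; rewrite GE.
apply: (@le_trans _ _ (\int[P]_(w in past Y1 s @^-1` (B `&` [set x | G s x = None]))
    (wait_at k s w)%:E)); last first.
  apply: aeV => //; first exact: measurable_wait_at.
  by move=> w [_ /= GE] /NV; rewrite GE.
have mBN : measurable (B `&` [set x | G s x = None]).
  by apply: measurableI => //; exact: mG.
rewrite -integral_wait//; have [B' mB' <-] := past_prefix mBN.
by apply: IH => //; rewrite addSnnS.
Qed.

Let total_cost G w :=
  c1%:E * tau1 R Y1 G w + cost2 H Y2 c2 J G2 (messages1 G (Y1 ^~ w)) w.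

Let total_cost_ge0 G w : 0 <= total_cost G w.
Proof.
rewrite adde_ge0// mule_ge0 ?lee_fin//.
by rewrite /tau1 /time_ereal; case: stop_time => [t|]; rewrite ?lee_fin ?leey.
Qed.

(** A final message sent at time [n + 1] comes after the stop of O2, hence has
    the effect of silence. *)
Let total_cost_stop G w t : stop_time (messages1 G (Y1 ^~ w)) = Some t ->
  (t <= n.+1)%N -> total_cost G w = policy_cost G n 1 w.
Proof.
set z := messages1 G _ => zt tn.
have [t0 zt0 zmin] := (stop_timeP _ _).1 zt.
have -> : total_cost G w = pay t z w.
  by rewrite /total_cost /tau1 -/z zt /= -EFinM.
rewrite /policy_cost -/z; move: tn; rewrite leq_eqVlt => /predU1P[tE|tn].
  rewrite first_stop_default; last by move=> r; rewrite add1n -tE; exact: zmin.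
  rewrite tE /pay; congr (_ + _); apply: cost2_received => r rn.
  rewrite !(@received_blank _ n)// => r' /andP[r0 r'n].
  by rewrite zmin// r0 tE.
case E: (z t) zt0 => [u|//] _.
rewrite (first_stopE _ _ zt E)//.
rewrite /pay; congr (_ + _); apply: cost2_received => r _.
by rewrite (received_message zt E).
Qed.

(** Stopping after time [n + 1], or never, only adds to the cost of O1. *)
Let policy_cost_le_total G w : policy_cost G n 1 w <= total_cost G w.
Proof.
case zt: (stop_time (messages1 G (Y1 ^~ w))) => [t|].
  have [tn|nt] := leqP t n.+1; first by rewrite (total_cost_stop zt).
  have [t0 zt0 zmin] := (stop_timeP _ _).1 zt.
  rewrite /policy_cost first_stop_default; last first.
    by move=> r /andP[r0 rn]; apply: zmin; rewrite r0 (leq_trans rn)// add1n ltnW.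
  rewrite /total_cost /pay /tau1 zt /= -EFinM; apply: leeD.
    by rewrite lee_fin ler_wpM2l// ler_nat ltnW.
  rewrite le_eqVlt; apply/orP; left; apply/eqP; apply: cost2_received => r rn.
  rewrite !(@received_blank _ n)// => r' /andP[r0 r'n].
  by apply: zmin; rewrite r0 (leq_ltn_trans r'n)// ltnW.
rewrite /total_cost /tau1 zt /= gt0_muley ?lte_fin// addye ?leey//.
by rewrite gt_eqF// (lt_le_trans _ (cost2_ge0 _ _))// ltNyr.
Qed.

Let least_cost := \int[P]_w (value_at n 1 1 w)%:E.

Let least_cost_le G : measurable_policy1 G ->
  least_cost <= cost P H Y1 Y2 c1 c2 J G2 G.
Proof.
move=> mG; have := @value_le_policy_cost G n 1 setT mG isT (add1n n) measurableT.
rewrite preimage_setT => /le_trans; apply.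
by apply: ge0_integral_mono => // w; exact: policy_cost_le_total.
Qed.

(** Almost surely only, because the belief may leave [[0, 1]], where a threshold
    rule waits. *)
Let late_null G := exists N : set Om, [/\ measurable N, P N = 0 &
  forall w, ~ N w -> exists2 t,
    stop_time (messages1 G (Y1 ^~ w)) = Some t & (t <= n.+1)%N].

Let prescribed_optimal G : measurable_policy1 G -> prescribed G -> late_null G ->
  optimal1 P H Y1 Y2 c1 c2 J G2 G.
Proof.
move=> mG GV [N [mN N0 Nstop]]; split; last first.
  move=> G' [mG' _]; apply: (@le_trans _ _ least_cost); last exact: least_cost_le.
  have := @policy_cost_le_value G n 1 setT mG GV isT (add1n n) measurableT.
  rewrite preimage_setT; apply: le_trans.
  apply: (ge0_integral_ae_mono _ _ _ mN N0) => //.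
  - exact: total_cost_ge0.
  - exact: measurable_policy_cost.
  - by move=> w /Nstop[t zt tn]; rewrite -(total_cost_stop zt).
split=> //; apply: (@le_lt_trans _ _ (\int[P]_w (cst (n.+1%:R)%:E w))).
  apply: (ge0_integral_ae_mono _ _ _ mN N0) => //.
  - move=> w; rewrite /tau1 /time_ereal.
    by case: stop_time => [t|]; rewrite ?lee_fin ?leey.
  - by move=> w; rewrite /= lee_fin.
  - by move=> w /Nstop[t zt tn]; rewrite /tau1 zt lee_fin ler_nat.
by rewrite integral_cst// ltey_eq fin_numM// fin_num_measure.
Qed.

(** * The threshold policy *)

Let measurable_pi t : (0 < t)%N -> measurable_fun setT (pi (t := t)).
Proof. by move=> t0; have [] := belief t0. Qed.

Let threshold_form t (g : R -> action) := exists (al be de th : R) (swap : bool),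
  [/\ ((0 <= al) && (al <= be) && (be <= de) && (de <= th) && (th <= 1))%R,
      threshold_rule (~~ swap) swap al be de th g
    & labels_aligned P H Y2 c2 J G2 t -> swap = false].

(** From time [n + 1] on the message is irrelevant: 1 is sent at every belief, the
    second interval being reduced to the point 1, where 1 has the priority. *)
Let late_rule t : exists g : R -> action,
  [/\ forall a, measurable [set x | g x = a], threshold_form t g &
      forall x, (0 <= x <= 1)%R -> g x <> None].
Proof.
exists (fun x => if ((0 <= x <= 1) && (true || ~~ (1 <= x <= 1)))%R then Some true
  else if (1 <= x <= 1)%R then Some false else None); split.
- by move=> a; exact: measurable_threshold.
- exists 0%R, 1%R, 1%R, 1%R, false; split=> //; first by rewrite !lexx !ler01.
  by apply: (threshold_ruleP true true false); rewrite ?lexx ?ler01.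
- by move=> x ->.
Qed.

Let early_rule t k : (0 < t)%N -> exists g : R -> action,
  [/\ forall a, measurable [set x | g x = a], threshold_form t g &
      exists N : set Om, [/\ measurable N, P N = 0 & forall w, ~ N w ->
        (if g (pi (past Y1 t w)) is Some u then stop_at t u t w
         else wait_at k t w) <= value_at k.+1 t t w]%R].
Proof.
move=> t0; have mpi := measurable_pi t0.
have mpiX : measurable_fun setT (fun w => pi (past Y1 t w)).
  exact: (measurableT_comp mpi (@measurable_past _ _ Y1 t)).
have [x0 x001 Px0] := exists_non_atom P mpiX.
pose coef h c := (c1 * t%:R + mean_cost2 (message t c) h)%R.
(* the first message is the one whose cost grows faster with the belief *)
pose swap := ~~ (coef false false - coef true false <=
  coef false true - coef true true)%R.
have slope : (coef false swap - coef true swap <=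
    coef false (~~ swap) - coef true (~~ swap))%R.
  rewrite /swap.
  by case: (leP (coef false false - _)%R (coef false true - _)%R) => //= /ltW.
have [al [be [de [th [g [chain rule mg opt]]]]]] :=
  threshold_optimal (superlinear_bayes_step t (superlinear_value k t.+1)) slope x001.
exists g; split=> //.
  exists al, be, de, th, swap; split=> // aligned.
  apply/negbTE; rewrite negbK.
  (* alignment compares the slopes of the costs of the two messages *)
  move: aligned; rewrite /labels_aligned !cond_cost2E -!EFinD lee_fin /coef => ?.
  lra.
(* where the belief is not a probability or is the exceptional point *)
pose N := past Y1 t @^-1` [set x | ~~ (0 <= pi x <= 1)%R] `|`
  (fun w => pi (past Y1 t w)) @^-1` [set x0].
have mN1 : measurable (past Y1 t @^-1` [set x | ~~ (0 <= pi x <= 1)%R]).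
  rewrite (_ : _ @^-1` _ =
      setT `&` (fun w => pi (past Y1 t w)) @^-1` ~` `[0%R, 1%R]%classic).
    by apply: mpiX => //; exact: measurableC.
  by rewrite setTI; apply/seteqP; split=> w /=; rewrite in_itv/= => /negP.
have mN2 : measurable ((fun w => pi (past Y1 t w)) @^-1` [set x0]).
  by rewrite -[X in measurable X]setTI; exact: mpiX.
exists N; split; first exact: measurableU.
  apply/eqP; rewrite -measure_le0 -[leRHS]adde0.
  rewrite -[X in (_ <= X + _)](belief_in01 t0) -[X in (_ <= _ + X)]Px0.
  exact: measureU2.
move=> w nN.
have pi01 : (0 <= pi (past Y1 t w) <= 1)%R.
  by apply: contrapT => /negP h; apply: nN; left.
have pix0 : pi (past Y1 t w) != x0.
  by apply/eqP => h; apply: nN; right.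
have := opt _ pi01 pix0; rewrite value_atS /stop_at /wait_at clipped_id//.
case: (g _) => [c [cW cc]|cW].
  by rewrite !le_min cW; rewrite (cc false) (cc true).
by rewrite !le_min (cW false) (cW true) lexx.
Qed.

Lemma threshold_policy_optimal : exists G1 : policy1 T1,
  optimal1 P H Y1 Y2 c1 c2 J G2 G1 /\
  forall t : nat, (0 < t)%N ->
    exists (al be de th : R) (g : R -> action) (swap : bool),
      [/\ ((0 <= al) && (al <= be) && (be <= de) && (de <= th) && (th <= 1))%R,
          forall y : t.-tuple T1, G1 t y = g (pi y),
          threshold_rule (~~ swap) swap al be de th g
        & labels_aligned P H Y2 c2 J G2 t -> swap = false].
Proof.
have rules t : exists g : R -> action, (0 < t)%N ->
    [/\ forall a, measurable [set x | g x = a], threshold_form t g,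
      (n < t)%N -> forall x, (0 <= x <= 1)%R -> g x <> None &
      forall k, (t + k.+1)%N = n.+1 ->
      exists N : set Om, [/\ measurable N, P N = 0 & forall w, ~ N w ->
        (if g (pi (past Y1 t w)) is Some u then stop_at t u t w
         else wait_at k t w) <= value_at k.+1 t t w]%R].
  have [t0|//] := posnP t; first by exists (fun=> None); rewrite t0.
  move=> t0; have [nt|tn] := ltnP n t.
    have [g [mg form late]] := late_rule t; exists g => _; split=> // k tk.
    by move: nt; rewrite -ltnS -tk addnS ltnS ltnNge leq_addr.
  have [g [mg form early]] := early_rule (n - t) t0; exists g => _; split=> //.
  move=> k tk; have -> // : k = (n - t)%N.
  by move: tk; rewrite addnS => -[<-]; rewrite addKn.
have [g gP] := choice rules.
(* the belief at time 0 may be non-measurable, whence the test on t *)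
pose G1 : policy1 T1 := fun t y => if (0 < t)%N then g t (pi y) else None.
have mG1 : measurable_policy1 G1.
  move=> t u; rewrite /G1; have [t0|t0] := posnP t.
    rewrite t0 /=; have [<-|nu] := eqVneq None u.
      by rewrite (_ : [set _ | _] = setT)//; apply/seteqP; split.
    rewrite (_ : [set _ | _] = set0)//; apply/seteqP; split=> // y /= h.
    by rewrite h eqxx in nu.
  have [mg _ _ _] := gP t t0; rewrite -[X in measurable X]setTI.
  exact: (measurable_pi t0 measurableT (mg u)).
exists G1; split; last first.
  move=> t t0; have [_ [al [be [de [th [swap [chain rule aligned]]]]]] _ _] := gP t t0.
  by exists al, be, de, th, (g t), swap; split=> // y; rewrite /G1 t0.
apply: prescribed_optimal => //.
  move=> k s s0 sk; have [_ _ _ /(_ k sk)[N [mN N0 NV]]] := gP s s0.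
  by exists N; split=> // w /NV; rewrite /G1 s0.
exists (past Y1 n.+1 @^-1` [set x | ~~ (0 <= pi x <= 1)%R]); split.
- rewrite (_ : [set x | _] = setT `&` pi (t := n.+1) @^-1` ~` `[0%R, 1%R]%classic).
    by apply: mX; apply: measurable_pi => //; exact: measurableC.
  by rewrite setTI; apply/seteqP; split=> x /=; rewrite in_itv/= => /negP.
- exact: belief_in01.
move=> w nN; have pi01 : (0 <= pi (past Y1 n.+1 w) <= 1)%R.
  by apply: contrapT => /negP h; exact: nN.
have [_ _ /(_ (leqnn _) _ pi01) stops _] := gP n.+1 isT.
case st : (stop_time (messages1 G1 (Y1 ^~ w))) => [t|].
  exists t => //; have [t0 _ tmin] := (stop_timeP _ _).1 st.
  rewrite leqNgt; apply/negP => nt.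
  by apply: stops; have := tmin n.+1; rewrite nt => /(_ isT).
by have := (stop_time_NoneP _).1 st n.+1 isT.
Qed.

End Model.
Theorem theorem8 (R : realType) (d d1 d2 : measure_display)
  (Om : measurableType d) (T1 : measurableType d1) (T2 : measurableType d2)
  (P : probability Om R) (H : {mfun Om >-> bool})
  (Y1 : nat -> {mfun Om >-> T1}) (Y2 : nat -> {mfun Om >-> T2})
  (p0 : R)
  (nu1 : nat -> {sigma_finite_measure set T1 -> \bar R})
  (nu2 : nat -> {sigma_finite_measure set T2 -> \bar R})
  (f1 : nat -> bool -> T1 -> R) (f2 : nat -> bool -> T2 -> R)
  (model : observation_model P H Y1 Y2 p0 nu1 nu2 f1 f2)
  (pi : forall t : nat, t.-tuple T1 -> R)
  (belief : is_belief1 P H Y1 pi)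
  (c1 c2 L : R) (J : bool -> bool -> R)
  (c1_gt0 : 0 < c1) (c2_gt0 : 0 < c2)
  (J_bounds : forall u h, 0 <= J u h <= L)
  (J1 : J true true < J false true) (J0 : J false false < J true false)
  (G2 : policy2 T2) (G2_meas : measurable_policy2 G2)
  (n : nat) (G2_finite : finite_horizon G2 n) :
  exists G1 : policy1 T1,
    optimal1 P H Y1 Y2 c1 c2 J G2 G1 /\
    forall t : nat, (0 < t)%N ->
      exists (al be de th : R) (g : R -> action) (swap : bool),
        [/\ (0 <= al) && (al <= be) && (be <= de) && (de <= th) && (th <= 1),
            forall y : t.-tuple T1, G1 t y = g (pi t y),
            threshold_rule (~~ swap) swap al be de th g
          & labels_aligned P H Y2 c2 J G2 t -> swap = false].
Proof.
exact: (threshold_policy_optimal model belief c1_gt0 c2_gt0 J_bounds G2_meas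
  G2_finite).
Qed.
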